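(* Let $I\subseteq \mathbb{C}[x_1,\ldots,x_n]$ be a square-free monomial ideal over $n$ variables. Then $I^{k}=I^{(k)}$ for all integers $k\geq 1$ if, and only if, $I^{k}=I^{(k)}$ for all integers $k$ with $1\le k\leq \max\left\{\lceil n/2\rceil, \lfloor n-\sqrt{4n+1}+1\rfloor\right\}$.
   Context: A square-free monomial ideal is an ideal of $\mathbb{C}[x_1,\ldots,x_n]$ generated by square-free monomials $\prod_{e\in C}x_e$, $C\subseteq[n]$. For an integer $k\ge 1$, the $k$th ordinary power $I^k$ is the ideal generated by all $k$-fold products of generators of $I$. Let $V(I)\subseteq\mathbb{C}^n$ be the set of points on which every polynomial in $I$ vanishes. The $k$th symbolic power $I^{(k)}$ is the set of polynomials $f\in\mathbb{C}[x_1,\ldots,x_n]$ such that $f$ and all its partial derivatives of order at most $k-1$ vanish on $V(I)$. *)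

(* Defs.v *)
From mathcomp Require Import all_boot all_order all_algebra.
From mathcomp Require Import boolp classical_sets reals complex mpoly.

Set Implicit Arguments.
Unset Strict Implicit.
Unset Printing Implicit Defensive.

Import Order.TTheory GRing.Theory Num.Theory.

Local Open Scope ring_scope.
Local Open Scope classical_set_scope.

(* Not [idealr_closed]: that predicate is boolean and excludes the unit ideal,
   which is the monomial ideal generated by the empty monomial 1. *)
Definition is_ideal (A : comNzRingType) (J : set A) : Prop :=
  [/\ J 0,
      forall x y, J x -> J y -> J (x + y) &
      forall a x, J x -> J (a * x)].

Definition ideal_gen (A : comNzRingType) (S : set A) : set A :=
  smallest (@is_ideal A) S.

(* The k factors need not be distinct. *)
Definition kfold_products (A : comNzRingType) (S : set A) (k : nat) : set A :=
  [set p | exists g : 'I_k -> A, (forall i, S (g i)) /\ p = \prod_(i < k) g i].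

(* The k-th power of the ideal generated by S. *)
Definition ordinary_power (A : comNzRingType) (S : set A) (k : nat) : set A :=
  ideal_gen (kfold_products S k).

Section Polynomials.

Variables (K : comNzRingType) (n : nat).

Definition sqfree_monomial (C : {set 'I_n}) : {mpoly K[n]} := \prod_(e in C) 'X_e.

(* There are only finitely many square-free monomials, so every set of them
   arises from a finite family F of subsets of 'I_n; F may be empty (zero ideal)
   and may contain set0 (unit ideal). *)
Definition sqfree_gens (F : {set {set 'I_n}}) : set {mpoly K[n]} :=
  [set sqfree_monomial C | C in [set` F]].

Definition zero_locus (I : set {mpoly K[n]}) : set ('I_n -> K) :=
  [set v | forall f, I f -> f.@[v] = 0].

(* A multi-index m with mdeg m = d gives a partial derivative of order d; the
   case mdeg m = 0 is f itself. *)
Definition symbolic_power (I : set {mpoly K[n]}) (k : nat) : set {mpoly K[n]} :=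
  [set f | forall m : 'X_{1..n}, (mdeg m <= k - 1)%N ->
           forall v, zero_locus I v -> (mderivm m f).@[v] = 0].

End Polynomials.

(* Main.v *)
Require Import Defs.
From mathcomp Require Import all_boot all_order all_algebra.
From mathcomp Require Import boolp classical_sets reals complex mpoly.
From mathcomp Require Import zify ring lra.

Set Implicit Arguments.
Unset Strict Implicit.
Unset Printing Implicit Defensive.

Import Order.TTheory GRing.Theory Num.Theory.

Local Open Scope ring_scope.

(** Everything is read off exponents. Call B a cover when it meets every member
    of F. A polynomial is in the k-th ordinary power iff every exponent vector w
    of it packs k members of F (k members, with repetition, whose sum is at most
    w), and in the k-th symbolic power iff every cover has w-weight at least k
    ([ordinary_powerP], [symbolic_powerP]; the zero locus is the union of the
    coordinate subspaces on which the variables of a cover vanish). So the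
    equality at k is the min-max statement [packs_at F k], and the claim is that
    [packs_at] for the bounded k forces it for all k
    ([packs_at_of_bounded]). Two arguments give the two terms of the maximum.

    Up to ceil(n/2): the family is ideal ([ideal_of_packs_at]), i.e. its
    fractional covers dominate convex combinations of covers. Deletions and
    contractions inherit the hypothesis, so a least non-ideal family would have
    only ideal proper minors. For such a family take a fractional vertex x and n
    independent members A tight at x. As in the proof of Lehman's theorem, a
    member missing j is no larger than the number of members of A containing j
    ([row_le_column]), and a de Bruijn-Erdos count then writes the all-one vector
    as a positive combination of A ([load_row_weights]). Hence every cover has
    more than x(S) elements, while at most x(S) members are disjoint, so
    [packs_at] fails already for some k at most ceil(n/2).

    Beyond ceil(n/2): let k be the least failure and w a minimal exponent vector
    on which it fails, with support S. Idealness gives a fractional packing of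
    value k, which can be taken with r linearly independent members; all its
    weights are below 1, because a member of weight at least 1 could be removed
    and k - 1 members packed in the rest. Every element of S lies in a cover of
    weight exactly k, and each packed member meets such a cover once. If d of
    these covers suffice to cover S and the largest has b elements in S, then
    independence gives r <= |S| + 1 - d, weights below 1 give r >= k + b, and
    |S| <= d b; so |S| + 1 - k >= d + b, which is at least 2 sqrt |S|. The
    borderline case |S| = d^2, d = b is excluded by exchanging one member of the
    packing for another ([extremal_failure_absurd]), which improves 4n to
    4n + 1. *)

(** * Linear algebra and linear programming duality *)

(** The one fact about dimension used below: fewer linear equations than unknowns
    leave a nonzero solution. *)
Lemma nonzero_solution (K : fieldType) (X Y : finType) (A : {set X})
    (B : {set Y}) (f : X -> Y -> K) :
  (#|B| < #|A|)%N ->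
  exists mu : X -> K, [/\ forall x, x \notin A -> mu x = 0,
    exists x, mu x != 0 & forall y, y \in B -> \sum_x mu x * f x y = 0].
Proof.
move=> ltBA.
pose M : 'M[K]_(#|A|, #|B|) := \matrix_(i, j) f (enum_val i) (enum_val j).
have : kermx M != 0.
  rewrite -mxrank_eq0 mxrank_ker subn_eq0 -ltnNge.
  exact: leq_ltn_trans (rank_leq_col M) ltBA.
case/rowV0Pn => v /sub_kermxP vM0 /rV0Pn[i0 vi0].
have /card_gt0P[a0 a0A] : (0 < #|A|)%N by apply: leq_ltn_trans ltBA.
exists (fun x => if x \in A then v 0 (enum_rank_in a0A x) else 0); split.
- by move=> x /negbTE->.
- by exists (enum_val i0); rewrite enum_valP enum_valK_in.
move=> y yB; rewrite (bigID (mem A)) /= [X in _ + X]big1 ?addr0; last first.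
  by move=> x /negbTE->; rewrite mul0r.
rewrite big_enum_val /=.
have := congr1 (fun N : 'rV_#|B| => N 0 (enum_rank_in yB y)) vM0.
rewrite !mxE => E; rewrite -[RHS]E; apply: eq_bigr => i _.
by rewrite enum_valP enum_valK_in mxE enum_rankK_in.
Qed.

(** Bartl's induction on the list of generators. If b fails to be nonnegative on
    the dual cone of the tail, at some y0, then composing every functional with the
    projection along y0 onto the kernel of the head generator a j0 reduces to the
    tail; undoing the projection puts a positive coefficient on a j0. *)
Lemma farkas (K : realFieldType) (J I : finType) (s : seq J) :
  forall (a : J -> I -> K) (b : I -> K),
  (forall y, (forall j, j \in s -> 0 <= \sum_i a j i * y i) ->
             0 <= \sum_i b i * y i) ->
  exists l : J -> K, [/\ forall j, 0 <= l j, forall j, j \notin s -> l j = 0 &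
    forall i, b i = \sum_j l j * a j i].
Proof.
elim: s => [|j0 s IHs] a b Hb.
  exists (fun=> 0); split=> // i; rewrite big1 => [|j _]; last by rewrite mul0r.
  have /Hb : forall j, j \in [::] -> 0 <= \sum_i a j i * - b i by [].
  have -> : \sum_i b i * - b i = - \sum_i b i ^+ 2.
    by rewrite -sumrN; apply: eq_bigr => ? _; rewrite mulrN expr2.
  rewrite oppr_ge0 => le0.
  have /eqP : \sum_i b i ^+ 2 = 0.
    by apply/eqP; rewrite eq_le le0 sumr_ge0 // => ? _; apply: sqr_ge0.
  rewrite psumr_eq0 => [/allP/(_ i (mem_index_enum i))|? _]; last exact: sqr_ge0.
  by rewrite sqrf_eq0 => /eqP.
have [Hs|] := pselect (forall y, (forall j, j \in s -> 0 <= \sum_i a j i * y i) ->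
    0 <= \sum_i b i * y i).
  have [l [l0 ls lb]] := IHs a b Hs; exists l; split=> // j.
  by rewrite inE negb_or => /andP[_ /ls].
move=> /existsNP[y0 /not_implyP[y0s /negP]]; rewrite -ltNge => by0.
have ay0 : \sum_i a j0 i * y0 i < 0.
  rewrite ltNge; apply/negP => ge0; move: by0; rewrite ltNge Hb // => j.
  by rewrite inE => /orP[/eqP->|/y0s].
set q := \sum_i a j0 i * y0 i in ay0.
pose t j := (\sum_i a j i * y0 i) / (- q).
pose u := (\sum_i b i * y0 i) / (- q).
have qN0 : - q != 0 by lra.
have dotD (c : I -> K) y : \sum_i (c i + (\sum_k c k * y0 k) / (- q) * a j0 i) * y i =
    \sum_i c i * (y i + (\sum_k a j0 k * y k) / (- q) * y0 i).
  transitivity (\sum_i c i * y i +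
      (\sum_k c k * y0 k) / (- q) * \sum_i a j0 i * y i).
    rewrite mulr_sumr -big_split; apply: eq_bigr => i _ /=.
    by rewrite mulrDl mulrA.
  transitivity (\sum_i c i * y i +
      (\sum_k a j0 k * y k) / (- q) * \sum_i c i * y0 i); first by congr +%R; ring.
  rewrite mulr_sumr -big_split; apply: eq_bigr => i _ /=.
  by rewrite mulrDr; congr +%R; ring.
have [|l [l0 ls lb]] := IHs (fun j i => a j i + t j * a j0 i)
    (fun i => b i + u * a j0 i).
  move=> y ys; rewrite dotD; apply: Hb => j; rewrite inE => /orP[/eqP->|js].
    have -> : \sum_i a j0 i * (y i + (\sum_k a j0 k * y k) / - q * y0 i) =
       \sum_k a j0 k * y k + (\sum_k a j0 k * y k) / - q * q.
      rewrite [in X in _ + X]/q mulr_sumr -big_split; apply: eq_bigr => i _ /=.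
      by rewrite mulrDr; congr +%R; ring.
    by rewrite mulrAC -mulrA invrN mulrN divff ?lt_eqF // mulrN1 subrr.
  by rewrite -dotD; apply: ys.
have u_lt0 : u < 0 by rewrite pmulr_llt0 // invr_gt0 oppr_gt0.
have c_ge0 : 0 <= \sum_j l j * t j - u.
  rewrite subr_ge0 (le_trans (ltW u_lt0)) // sumr_ge0 // => j _.
  have [/y0s ge0|/ls->] := boolP (j \in s); last by rewrite mul0r.
  by rewrite mulr_ge0 // mulr_ge0 // invr_ge0 oppr_ge0 ltW.
exists (fun j => l j + (if j == j0 then \sum_j l j * t j - u else 0)); split.
- by move=> j; case: eqP => _; rewrite ?addr0 // addr_ge0.
- by move=> j; rewrite inE negb_or => /andP[/negbTE-> /ls->]; rewrite addr0.
move=> i; have -> : b i = \sum_j l j * (a j i + t j * a j0 i) - u * a j0 i.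
  by rewrite -lb; ring.
rewrite [RHS](eq_bigr (fun j => l j * a j i +
   (if j == j0 then (\sum_j l j * t j - u) * a j0 i else 0))); last first.
  by move=> j _; case: eqP => [->|_]; rewrite ?addr0 ?mulrDl.
rewrite big_split /= -big_mkcond big_pred1_eq mulrBl addrA; congr (_ - _).
rewrite mulr_suml -big_split; apply: eq_bigr => j _ /=.
by rewrite mulrDr mulrA.
Qed.

Definition hits (T : finType) (F : {set {set T}}) (B : {set T}) : bool :=
  [forall C in F, [exists e in C, e \in B]].

Definition load (T : finType) (lam : {set T} -> rat) (e : T) : rat :=
  \sum_(C : {set T} | e \in C) lam C.

Lemma hitsP (T : finType) (F : {set {set T}}) (B : {set T}) :
  reflect (forall C, C \in F -> exists2 e, e \in C & e \in B) (hits F B).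
Proof.
apply: (iffP forall_inP) => H C /H; first by case/exists_inP => e; exists e.
by move/exists_inP.
Qed.

(** Double counting of incidences between elements and weighted sets. *)
Lemma sum_load (T : finType) (x : T -> rat) (lam : {set T} -> rat) :
  \sum_e x e * load lam e = \sum_C lam C * \sum_(e in C) x e.
Proof.
under eq_bigr => e _ do rewrite mulr_sumr.
rewrite (exchange_big_dep xpredT) //=; apply: eq_bigr => C _.
by rewrite mulr_sumr; apply: eq_bigr => e _; rewrite mulrC.
Qed.

Lemma sum_indicator (T : finType) (C B : {set T}) :
  \sum_(e in C) (e \in B)%:R = #|C :&: B|%:R :> rat.
Proof.
rewrite -sum1_card natr_sum big_mkcond [RHS]big_mkcond /=.
by apply: eq_bigr => e _; rewrite inE; case: (e \in C); case: (e \in B).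
Qed.

Lemma sum_load_in (T : finType) (B : {set T}) (lam : {set T} -> rat) :
  \sum_(e in B) load lam e = \sum_C lam C * #|C :&: B|%:R.
Proof.
have := sum_load (fun e => (e \in B)%:R) lam.
rewrite (eq_bigr (fun e => if e \in B then load lam e else 0)); last first.
  by move=> e _; case: ifP; rewrite ?mul1r ?mul0r.
rewrite -big_mkcond /= => ->; apply: eq_bigr => C _; congr (_ * _).
by rewrite -sum_indicator.
Qed.

(** Linear programming duality for packings. Applied to a family it turns ideal
    weights into fractional packings; applied to the covers of a family it turns
    points into convex combinations of covers. The extra coordinate of the cone
    records the total mass of the packing. *)
Lemma fractional_packing (T : finType) (H : {set {set T}}) (u : T -> rat) :
  (forall e, 0 <= u e) ->
  (forall x, (forall e, 0 <= x e) ->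
     (forall C, C \in H -> 1 <= \sum_(e in C) x e) -> 1 <= \sum_e u e * x e) ->
  exists lam : {set T} -> rat, [/\ forall C, 0 <= lam C,
    forall C, C \notin H -> lam C = 0, \sum_C lam C = 1 &
    forall e, load lam e <= u e].
Proof.
move=> u0 Hu.
pose a (j : {set T} + T) (i : T + 'I_1) : rat := match j, i with
  | inl C, inl e => (e \in C)%:R | inl C, inr _ => 1
  | inr e', inl e => (e == e')%:R | inr _, inr _ => 0 end.
pose b (i : T + 'I_1) : rat := match i with inl e => u e | inr _ => 1 end.
pose s := enum [pred j : {set T} + T | if j is inl C then C \in H else true].
have aC C (y : T + 'I_1 -> rat) : \sum_i a (inl C) i * y i =
    \sum_(e in C) y (inl e) + y (inr ord0).
  rewrite big_sumType /= big_ord1 mul1r [X in _ = X + _]big_mkcond /=; congr +%R.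
  by apply: eq_bigr => e _; case: (e \in C); rewrite ?mul1r ?mul0r.
have [|l [l0 ls lb]] := @farkas rat _ _ s a b.
  move=> y ys; rewrite big_sumType /= big_ord1.
  pose z e := y (inl e); set h := y (inr ord0).
  have z0 e : 0 <= z e.
    have := ys (inr e); rewrite mem_enum inE => /(_ isT).
    rewrite big_sumType /= big_ord1 mul0r addr0 (bigD1 e) //= eqxx mul1r.
    by rewrite big1 ?addr0 // => e' /negbTE->; rewrite mul0r.
  have zC C : C \in H -> - h <= \sum_(e in C) z e.
    move=> CH; have := ys (inl C); rewrite mem_enum inE => /(_ CH).
    by rewrite aC => yC; rewrite -subr_ge0 opprK.
  have uz0 : 0 <= \sum_e u e * z e by apply: sumr_ge0 => e _; apply: mulr_ge0.
  have [h0|h0] := leP 0 h; first by apply: addr_ge0; rewrite ?mul1r.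
  have := Hu (fun e => z e / - h) => Hz.
  have {Hz} : 1 <= \sum_e u e * (z e / - h).
    apply: Hz => [e|C CH]; first by rewrite divr_ge0 // oppr_ge0 ltW.
    by rewrite -mulr_suml ler_pdivlMr ?oppr_gt0 // mul1r zC.
  rewrite (eq_bigr (fun e => u e * z e * (- h)^-1)); last by move=> e _; rewrite mulrA.
  by rewrite -mulr_suml ler_pdivlMr ?oppr_gt0 // !mul1r -subr_ge0 opprK.
exists (fun C => l (inl C)); split=> //.
- by move=> C CH; apply: ls; rewrite mem_enum.
- have := lb (inr ord0); rewrite big_sumType /= [X in _ + X]big1 => [|? _].
    by rewrite addr0 => ->; apply: eq_bigr => C _; rewrite mulr1.
  by rewrite mulr0.
move=> e; have := lb (inl e); rewrite big_sumType /= => ->.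
rewrite [X in _ <= X + _](_ : _ = load (fun C => l (inl C)) e); last first.
  rewrite /load [RHS]big_mkcond; apply: eq_bigr => C _.
  by case: (e \in C); rewrite ?mulr1 ?mulr0.
by rewrite lerDl sumr_ge0 // => ? _; rewrite mulr_ge0.
Qed.

(** The mass of lam is squeezed between the two sides: each set counts at least
    once on D, and the load on D is at most the capacity of D. *)
Lemma complementary_slackness (T : finType) (lam : {set T} -> rat)
    (u : T -> rat) (D : {set T}) :
  (forall C, 0 <= lam C) -> (forall C, lam C != 0 -> (0 < #|C :&: D|)%N) ->
  (forall e, e \in D -> load lam e <= u e) ->
  \sum_(e in D) u e <= \sum_C lam C ->
  (forall e, e \in D -> load lam e = u e) /\
  (forall C, lam C != 0 -> #|C :&: D| = 1%N).
Proof.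
move=> lam0 lamD lamu uD.
have le1 C : lam C <= lam C * #|C :&: D|%:R.
  have [->|lC] := eqVneq (lam C) 0; first by rewrite mul0r.
  by rewrite ler_peMr // ler1n lamD.
have lo : \sum_(e in D) load lam e <= \sum_(e in D) u e by apply: ler_sum.
have hi : \sum_C lam C <= \sum_(e in D) load lam e.
  by rewrite sum_load_in; apply: ler_sum.
have E1 : \sum_(e in D) (u e - load lam e) = 0 by rewrite sumrB; lra.
have E2 : \sum_C (lam C * #|C :&: D|%:R - lam C) = 0.
  by rewrite sumrB -sum_load_in; lra.
split=> [e eD|C lC].
  move/eqP: E1; rewrite psumr_eq0 => [/allP/(_ e (mem_index_enum e))|? ?].
    by rewrite eD subr_eq0 => /eqP.
  by rewrite subr_ge0 lamu.
move/eqP: E2; rewrite psumr_eq0 => [/allP/(_ C (mem_index_enum C))|? _].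
  rewrite /= subr_eq0 -{2}[lam C]mulr1 => /eqP/(mulfI lC)/eqP.
  by rewrite -[1]/(1%:R) eqr_nat => /eqP.
by rewrite subr_ge0.
Qed.

(** * Integral packings and minors *)

(** The width-length form of idealness: by duality it says that every fractional
    cover x dominates a convex combination of covers. *)
Definition ideal_family (T : finType) (F : {set {set T}}) : Prop :=
  forall w x : T -> rat,
    (forall e, 0 <= w e) -> (forall B, hits F B -> 1 <= \sum_(e in B) w e) ->
    (forall e, 0 <= x e) -> (forall C, C \in F -> 1 <= \sum_(e in C) x e) ->
  1 <= \sum_e w e * x e.

Definition pack (T : finType) (F : {set {set T}}) (w : T -> nat) (k : nat) : Prop :=
  exists g : 'I_k -> {set T}, (forall i, g i \in F) /\
    forall e, (\sum_(i < k) (e \in g i) <= w e)%N.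

(** The combinatorial form of the equality of the k-th ordinary and symbolic
    powers. *)
Definition packs_at (T : finType) (F : {set {set T}}) (k : nat) : Prop :=
  forall w : T -> nat, (forall B, hits F B -> (k <= \sum_(e in B) w e)%N) ->
    pack F w k.

Definition deletion (T : finType) (F : {set {set T}}) (j : T) : {set {set T}} :=
  [set C in F | j \notin C]%SET.

Definition contraction (T : finType) (F : {set {set T}}) (j : T) : {set {set T}} :=
  [set C :\ j | C in F]%SET.

(** Weak duality between a packing and a weight y on the elements. *)
Lemma pack_weight (T : finType) (F : {set {set T}}) (w : T -> nat) k
    (y : T -> rat) (c : rat) :
  pack F w k -> (forall e, 0 <= y e) ->
  (forall C, C \in F -> c <= \sum_(e in C) y e) ->
  c * k%:R <= \sum_e y e * (w e)%:R.
Proof.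
case=> g [gF gw] y0 yF.
apply: (@le_trans _ _ (\sum_(i < k) \sum_(e in g i) y e)).
  rewrite mulr_natr -[k in leLHS]card_ord -sumr_const.
  by apply: ler_sum => i _; apply: yF.
rewrite (exchange_big_dep xpredT) //=; apply: ler_sum => e _.
rewrite sumr_const -[leLHS]mulr_natr ler_wpM2l // ler_nat; apply: leq_trans (gw e).
rewrite -sum1_card big_mkcond /=; apply: leq_sum => i _.
by rewrite unfold_in; case: ifP => // gie; rewrite lt0b.
Qed.

Lemma packs_at0 (T : finType) (F : {set {set T}}) : packs_at F 0.
Proof.
by move=> w _; exists (fun=> finset.set0); split=> [[]|e] //; rewrite big_ord0.
Qed.

(** Deleting j amounts to giving j capacity 0. *)
Lemma deletion_packs_at (T : finType) (F : {set {set T}}) (j : T) k :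
  packs_at F k -> packs_at (deletion F j) k.
Proof.
move=> Fk w wB; pose w' e := if e == j then 0%N else w e.
have [B FB|g [gF gw]] := Fk w'.
  have -> : (\sum_(e in B) w' e = \sum_(e in B :\ j) w e)%N.
    rewrite [RHS]big_mkcond [LHS]big_mkcond /=; apply: eq_bigr => e _.
    by rewrite !inE /w'; case: eqP => //=; case: ifP.
  apply: wB; apply/hitsP => C; rewrite inE => /andP[CF jC].
  have [e eC eB] := hitsP _ _ FB C CF; exists e => //; rewrite !inE eB andbT.
  by apply: contraNneq jC => <-.
exists g; split=> [i|e].
  rewrite inE gF /=; apply/negP => ji; have := gw j.
  by rewrite /w' eqxx (bigD1 i) //= ji.
by apply: leq_trans (gw e) _; rewrite /w'; case: eqP.
Qed.

(** Contracting j amounts to giving j capacity k, which no packing of k sets can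
    exhaust. *)
Lemma contraction_packs_at (T : finType) (F : {set {set T}}) (j : T) k :
  packs_at F k -> packs_at (contraction F j) k.
Proof.
move=> Fk w wB; pose w' e := if e == j then k else w e.
have [B FB|g [gF gw]] := Fk w'.
  have [jB|jB] := boolP (j \in B).
    by rewrite (bigD1 j) //= {1}/w' eqxx leq_addr.
  rewrite (eq_bigr w) => [|e eB]; last first.
    by rewrite /w'; case: eqP => // ej; rewrite -ej eB in jB.
  apply: wB; apply/hitsP => _ /imsetP[C CF ->].
  have [e eC eB] := hitsP _ _ FB C CF; exists e => //; rewrite !inE eC andbT.
  by apply: contraNneq jB => <-.
exists (fun i => g i :\ j)%SET; split=> [i|e]; first exact: imset_f.
have [->|ej] := eqVneq e j.
  by rewrite big1 // => i _; rewrite !inE eqxx.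
have := gw e; rewrite /w' (negbTE ej); apply: leq_trans; apply: leq_sum => i _.
by rewrite !inE ej.
Qed.

(** * Idealness from packings up to half the ground set *)

(** A vertex of the polyhedron of fractional covers, found by maximising the
    number of tight constraints: from a point with a nonzero direction preserving
    the tight constraints, moving along it without increasing the objective until
    a new constraint becomes tight would do better. *)
Lemma vertex_below_one (T : finType) (F : {set {set T}}) (S : {set T})
    (w x0 : T -> rat) :
  (forall C, C \in F -> C \subset S) -> (forall e, 0 <= w e) ->
  (forall e, 0 <= x0 e) -> (forall C, C \in F -> 1 <= \sum_(e in C) x0 e) ->
  \sum_e w e * x0 e < 1 ->
  exists x : T -> rat,
    [/\ [/\ forall e, 0 <= x e, forall e, e \notin S -> x e = 0,
         forall C, C \in F -> 1 <= \sum_(e in C) x e & \sum_e w e * x e < 1] &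
     forall d : T -> rat,
       (forall C, C \in F -> \sum_(e in C) x e = 1 -> \sum_(e in C) d e = 0) ->
       (forall e, x e = 0 -> d e = 0) -> forall e, d e = 0].
Proof.
move=> FS w0 x00 x0F wx0.
pose good x := [/\ forall e, 0 <= x e, forall e, e \notin S -> x e = 0,
         forall C, C \in F -> 1 <= \sum_(e in C) x e & \sum_e w e * x e < 1].
pose dir (d : T -> rat) (j : {set T} + T) : rat :=
  match j with inl C => \sum_(e in C) d e | inr e => d e end.
pose rhs (j : {set T} + T) : rat := if j is inl _ then 1 else 0.
pose cons := [set j : {set T} + T | if j is inl C then C \in F else true]%SET.
pose tight x := [set j in cons | dir x j == rhs j]%SET.
pose P m := `[< exists2 x, good x & #|tight x| = m >].
have exP : exists m, P m.
  (* coordinates outside S are irrelevant, and are set to 0 *)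
  pose x1 e := if e \in S then x0 e else 0.
  exists #|tight x1|; apply/asboolP; exists x1 => //; split.
  - by move=> e; rewrite /x1; case: ifP.
  - by move=> e /negbTE; rewrite /x1 => ->.
  - move=> C CF; rewrite (eq_bigr x0) ?x0F // => e eC.
    by rewrite /x1 (fintype.subsetP (FS C CF)).
  - apply: le_lt_trans wx0; apply: ler_sum => e _; apply: ler_wpM2l => //.
    by rewrite /x1; case: ifP.
have bP m : P m -> (m <= #|cons|)%N.
  move=> /asboolP[x _ <-]; apply/subset_leq_card/fintype.subsetP => j.
  by rewrite inE => /andP[].
case: (ex_maxnP exP bP) => m /asboolP[x gx <-] maxm; exists x; split=> //.
have [x_ge0 xS xF wx] := gx.
move=> d dF d0 e1; apply/eqP/contraT => de1.
have dirD t d' j : dir (fun e => x e + t * d' e) j = dir x j + t * dir d' j.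
  by case: j => [C|e] //=; rewrite mulr_sumr -big_split.
(* a sign of d for which the objective does not increase and some coordinate
   decreases, so that the move meets a new constraint *)
have {de1 e1} [d' [d'F d'0 wd' [e d'e]]] : exists d', [/\
    (forall C, C \in F -> \sum_(e in C) x e = 1 -> \sum_(e in C) d' e = 0),
    (forall e, x e = 0 -> d' e = 0), \sum_e w e * d' e <= 0 &
    exists e, d' e < 0].
  wlog wd : d dF d0 de1 / \sum_e w e * d e <= 0 => [Hw|].
    have [/Hw|wd] := leP (\sum_e w e * d e) 0; first exact.
    apply: (Hw (fun e => - d e)).
    - by move=> C CF /dF E; rewrite sumrN E ?oppr0.
    - by move=> e /d0->; rewrite oppr0.
    - by rewrite oppr_eq0.
    - by under eq_bigr do rewrite mulrN; rewrite sumrN oppr_le0 ltW.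
  have [[e de]|noe] := pselect (exists e, d e < 0).
    by exists d; split=> //; exists e.
  have d_ge0 e : 0 <= d e by rewrite leNgt; apply/negP => de; apply: noe; exists e.
  exists (fun e => - d e); split.
  - by move=> C CF /dF E; rewrite sumrN E ?oppr0.
  - by move=> e /d0->; rewrite oppr0.
  - under eq_bigr do rewrite mulrN; rewrite sumrN oppr_le0.
    by apply: sumr_ge0 => e _; apply: mulr_ge0.
  - by exists e1; rewrite oppr_lt0 lt0r de1 d_ge0.
have slack_ge0 j : j \in cons -> 0 <= dir x j - rhs j.
  by rewrite inE; case: j => [C /xF|e' _] /=; rewrite ?subr0 // subr_ge0.
have tight0 j : j \in tight x -> dir d' j = 0.
  rewrite !inE; case: j => [C /andP[CF /eqP xC]|e' /eqP xe] /=; [exact: d'F|exact: d'0].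
pose neg j := (j \in cons) && (dir d' j < 0).
have nege : neg (inr e) by rewrite /neg inE.
pose ratio j := (dir x j - rhs j) / - dir d' j.
case: (@arg_minP _ _ _ _ neg ratio nege) => j0 /andP[j0c j0d] minj0.
set t := ratio j0 in minj0.
have t0 : 0 <= t by rewrite divr_ge0 ?slack_ge0 // oppr_ge0 ltW.
pose x' e := x e + t * d' e.
have x'c j : j \in cons -> rhs j <= dir x' j.
  move=> jc; rewrite dirD; have s0 := slack_ge0 j jc.
  have [dj|dj] := leP 0 (dir d' j).
    by apply: (@le_trans _ _ (dir x j)); [rewrite -subr_ge0|rewrite lerDl mulr_ge0].
  have := minj0 j; rewrite /neg jc dj => /(_ isT).
  by rewrite /ratio ler_pdivlMr ?oppr_gt0 //; lra.
have gx' : good x'.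
  split.
  - by move=> e'; have := x'c (inr e'); rewrite inE => /(_ isT).
  - by move=> e' /xS xe; rewrite /x' xe d'0 // mulr0 addr0.
  - by move=> C CF; have := x'c (inl C); rewrite inE => /(_ CF).
  - apply: le_lt_trans wx; rewrite /x'.
    rewrite (eq_bigr (fun e => w e * x e + t * (w e * d' e))); last by move=> *; ring.
    by rewrite big_split /= -mulr_sumr gerDl mulr_ge0_le0.
have : (#|tight x'| <= #|tight x|)%N by apply: maxm; apply/asboolP; exists x'.
rewrite leqNgt => /negP[]; apply/proper_card/properP; split.
  apply/fintype.subsetP => j jt; have := jt; rewrite !inE dirD tight0 // mulr0 addr0.
  by case: j jt.
exists j0; last by apply/negP => /tight0 d0'; rewrite d0' ltxx in j0d.
rewrite inE j0c dirD /t /ratio /=.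
by apply/eqP; field; rewrite lt_eqF.
Qed.

(** Minimal among the separating subfamilies: a linear dependency would make one
    more member superfluous, and fewer than #|S| members cannot separate. *)
Lemma separating_basis (T : finType) (S : {set T}) (U : {set {set T}}) :
  let sep (A : {set {set T}}) := forall d : T -> rat,
    (forall e, e \notin S -> d e = 0) ->
    (forall C, C \in A -> \sum_(e in C) d e = 0) -> forall e, d e = 0 in
  sep U -> exists A : {set {set T}}, [/\ A \subset U, #|A| = #|S| & sep A].
Proof.
move=> sep sepU; pose P (A : {set {set T}}) := `[< A \subset U /\ sep A >].
have PU : P U by apply/asboolP.
case: (arg_minnP (fun A : {set {set T}} => #|A|) PU) => A /asboolP[AU sepA] minA.
exists A; split=> //; apply/eqP; rewrite eqn_leq; apply/andP; split.
  rewrite leqNgt; apply/negP => /nonzero_solution - /(_ rat (fun C e => (e \in C)%:R)).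
  case=> mu [muA [C0 muC0] mu0].
  have C0A : C0 \in A by apply: contraNT muC0 => /muA->.
  have : (#|A| <= #|A :\ C0|)%N.
    apply: minA; apply/asboolP; split.
      by apply: fintype.subset_trans AU; apply: subsetDl.
    move=> d dS dA; apply: sepA => // C CA.
    have [->{C CA}|CC0] := eqVneq C C0; last by apply: dA; rewrite !inE CC0.
    have := sum_load d mu; rewrite big1 => [|e _]; last first.
      have [eS|/dS->] := boolP (e \in S); last by rewrite mul0r.
      rewrite /load big_mkcond /=.
      rewrite (eq_bigr (fun C => mu C * (e \in C)%:R)) ?mu0 ?mulr0 // => C _.
      by case: (e \in C); rewrite ?mulr1 ?mulr0.
    rewrite (bigD1 C0) //= [X in _ + X]big1 ?addr0 => [|C CC0].
      by move=> /esym/eqP; rewrite mulf_eq0 (negbTE muC0) => /eqP.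
    have [CA|/muA->] := boolP (C \in A); last by rewrite mul0r.
    by rewrite dA ?mulr0 // !inE CC0.
  by rewrite (cardsD1 C0 A) C0A add1n ltnn.
rewrite leqNgt; apply/negP => /nonzero_solution - /(_ rat (fun e C => (e \in C)%:R)).
case=> d [dS [e de] dA]; move/eqP: de; apply.
apply: sepA => // C /dA E; rewrite -[RHS]E.
rewrite [LHS]big_mkcond; apply: eq_bigr => e1 _ /=.
by case: (_ \in C); rewrite ?mulr1 ?mulr0.
Qed.

(** The situation of a least non-ideal family on the ground set S: w witnesses that
    it is not ideal, x is a vertex below w, and A is a basis of the constraints
    tight at x, all of which are members because x is positive on S. *)
Section MinimallyNonideal.

Variables (T : finType) (F A : {set {set T}}) (S : {set T}) (w x : T -> rat).

Hypothesis FS : forall C, C \in F -> C \subset S.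
Hypothesis w_hits : forall B, hits F B -> 1 <= \sum_(e in B) w e.
Hypothesis x_gt0 : forall e, e \in S -> 0 < x e.
Hypothesis x_out : forall e, e \notin S -> x e = 0.
Hypothesis x_ge1 : forall C, C \in F -> 1 <= \sum_(e in C) x e.
Hypothesis wx_lt1 : \sum_e w e * x e < 1.
Hypothesis AF : A \subset F.
Hypothesis A_tight : forall C, C \in A -> \sum_(e in C) x e = 1.
Hypothesis cardA : #|A| = #|S|.
Hypothesis A_sep : forall d : T -> rat, (forall e, e \notin S -> d e = 0) ->
  (forall C, C \in A -> \sum_(e in C) d e = 0) -> forall e, d e = 0.
Hypothesis ideal_del : forall j, j \in S -> ideal_family (deletion F j).

Let x_ge0 e : 0 <= x e.
Proof. by have [/x_gt0/ltW|/x_out->] := boolP (e \in S). Qed.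

Let AS C : C \in A -> C \subset S.
Proof. by move=> CA; apply: FS; apply: (fintype.subsetP AF). Qed.

Let A_col e : e \in S -> exists2 D, D \in A & e \in D.
Proof.
move=> eS.
have [[D DA jD]|noD] := pselect (exists2 D, D \in A & e \in D); first by exists D.
have := A_sep (d := fun e' => (e' == e)%:R) _ _ e; rewrite eqxx => E.
suff : (1 : rat) = 0 by move/eqP; rewrite oner_eq0.
apply: E => [e' e'S|D DA]; first by case: eqP => // ej; rewrite -ej (negbTE e'S) in eS.
by rewrite big1 // => e' eD; case: eqP => // ej; case: noD; exists D; rewrite -?ej.
Qed.

(** Otherwise B would solve the linear system that determines x, and x would be the
    indicator of a cover, of objective at least 1. *)
Lemma tight_row_overhit B : hits F B -> exists2 C, C \in A & (1 < #|C :&: B|)%N.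
Proof.
move=> FB; have [[C CA CB]|noC] := pselect (exists2 C, C \in A & (1 < #|C :&: B|)%N).
  by exists C.
have CB C : C \in A -> #|C :&: B| = 1%N.
  move=> CA; apply/eqP; rewrite eqn_leq leqNgt; apply/andP; split.
    by apply/negP => ?; apply: noC; exists C.
  have [e eC eB] := hitsP _ _ FB C (fintype.subsetP AF _ CA).
  by apply/card_gt0P; exists e; rewrite inE eC.
have xB e : x e - (e \in S :&: B)%:R = 0.
  apply: (A_sep (d := fun e => x e - (e \in S :&: B)%:R)) => [e' e'S|C CA].
    by rewrite x_out // inE (negbTE e'S) subr0.
  rewrite sumrB sum_indicator A_tight // finset.setIA (finset.setIidPl (AS CA)) CB //.
have : hits F (S :&: B).
  apply/hitsP => C CF; have [e eC eB] := hitsP _ _ FB C CF.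
  by exists e; rewrite // inE eB (fintype.subsetP (FS CF)).
move=> /w_hits; rewrite leNgt => /negP[]; apply: le_lt_trans wx_lt1.
rewrite big_mkcond; apply: ler_sum => e _ /=.
have /eqP := xB e; rewrite subr_eq0 => /eqP->.
by case: (e \in _); rewrite ?mulr1 ?mulr0.
Qed.

(** Otherwise the indicator of j solves the system that determines x. *)
Lemma column_not_full j : j \in S -> exists2 C, C \in A & j \notin C.
Proof.
move=> jS; have [[C CA CB]|noC] := pselect (exists2 C, C \in A & j \notin C).
  by exists C.
have jC C : C \in A -> j \in C.
  by move=> CA; apply: contraT => jC; case: noC; exists C.
have I1 (C : {set T}) :
    (C :&: [set j] = if j \in C then [set j] else finset.set0)%SET.
  apply/setP => e; rewrite !inE; have [->|ej] := eqVneq e j.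
    by rewrite andbT; case: ifP; rewrite !inE ?eqxx.
  by rewrite andbF; case: ifP; rewrite !inE // (negbTE ej).
have xj e : x e - (e \in [set j]%SET)%:R = 0.
  apply: (A_sep (d := fun e => x e - (e \in [set j]%SET)%:R)) => [e' e'S|C CA].
    rewrite x_out // inE; case: eqP => [ej|]; last by rewrite subr0.
    by rewrite -ej (negbTE e'S) in jS.
  by rewrite sumrB sum_indicator A_tight // I1 jC // cards1 subrr.
have [|C CA] := @tight_row_overhit [set j]%SET.
  apply/hitsP => C CF; exists j; last by rewrite inE.
  apply: contraT => jnC; have := x_ge1 CF; rewrite big1 ?ler10 // => e eC.
  have /eqP := xj e; rewrite subr_eq0 inE => /eqP->.
  by case: eqP => // ej; rewrite -ej eC in jnC.
by rewrite I1 jC // cards1.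
Qed.

(** A tight member equal to S would contain all the others properly, which then
    could not be tight as well, since x is positive on S. *)
Lemma row_not_full C : C \in A -> (#|C| < #|S|)%N.
Proof.
move=> CA; apply: proper_card; rewrite finset.properEneq AS // andbT.
apply/negP => /eqP CS.
have [e eC] : exists e, e \in C.
  apply/existsP; apply: contraT; rewrite negb_exists => /forallP Ce.
  have := A_tight CA; rewrite big_pred0 => [/eqP|e]; first by rewrite eq_sym oner_eq0.
  exact/negbTE.
have eS : e \in S by rewrite -CS.
have [D DA eD] := column_not_full eS.
have := A_tight CA; rewrite (finset.big_setID D) /= (finset.setIidPr _) ?CS ?AS //.
rewrite A_tight // => E; have : \sum_(e in S :\: D) x e = 0 by lra.
move/eqP; rewrite psumr_eq0 => [/allP/(_ e (mem_index_enum e))|? _]; last exact: x_ge0.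
by rewrite inE eD eS /= => /eqP xe; have := x_gt0 eS; rewrite xe ltxx.
Qed.

(** The step where minimality enters. Away from j the point x dominates a convex
    combination of covers of the deletion of j. All of them meet C exactly once,
    so each e in C is picked out by one of them, b e, to which j is added. Were C
    larger than the column of j, some nonzero combination v of the b e would vanish
    on the members containing j; on the others it takes the constant value v j.
    These are also the values of v j times (x - indicator of j), so the two
    vectors are equal, and comparing them at j, where x is at most 1, gives
    v = 0. But the coordinates of v on C are the coefficients of the
    combination. *)
Lemma row_le_column C j : C \in A -> j \in S -> j \notin C ->
  (#|C| <= #|[set D in A | j \in D]%SET|)%N.
Proof.
move=> CA jS jC.
pose Fj := deletion F j.
have FjF D : D \in Fj -> D \in F by rewrite inE => /andP[].
pose H := [set B | hits Fj B]%SET.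
have [//||gam [gam0 gamH gam1 gamx]] := @fractional_packing T H x.
  move=> y y0 yH; under eq_bigr do rewrite mulrC.
  apply: (ideal_del jS) => // [B FB|D /FjF]; last exact: x_ge1.
  by apply: yH; rewrite inE.
have gam_tight D : D \in A -> j \notin D ->
    (forall e, e \in D -> load gam e = x e) /\
    (forall B, gam B != 0 -> #|B :&: D| = 1%N).
  move=> DA jD.
  apply: complementary_slackness => // [B gB|]; last by rewrite A_tight // gam1.
  have : B \in H by apply: contraNT gB => /gamH->.
  rewrite inE => /hitsP/(_ D) [|e eD eB].
    by rewrite inE jD (fintype.subsetP AF).
  by apply/card_gt0P; exists e; rewrite inE eB.
have selB e : {B | e \in C -> gam B != 0 /\ e \in B}.
  apply: cid; have [eC|eC] := boolP (e \in C); last by exists finset.set0.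
  have [/(_ e eC) le _] := gam_tight C CA jC.
  have xe : 0 < x e by apply: x_gt0; apply: (fintype.subsetP (AS CA)).
  have [[B gB eB]|noB] := pselect (exists2 B, gam B != 0 & e \in B).
    by exists B.
  move: xe; rewrite -le /load big1 ?ltxx // => B eB.
  by apply/eqP; apply: contraT => gB; case: noB; exists B.
pose b e := (j |: sval (selB e))%SET.
have bD e D : e \in C -> D \in A -> j \notin D -> #|D :&: b e| = 1%N.
  move=> eC DA jD; have [_ /(_ (sval (selB e)))] := gam_tight D DA jD.
  have [ge _] := svalP (selB e) eC; move/(_ ge) => <-.
  congr #|pred_of_set _|; apply/setP => e'; rewrite !inE.
  by have [->|] := eqVneq e' j; rewrite ?(negbTE jD) ?andbF //= andbC.
rewrite leqNgt; apply/negP.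
move=> /nonzero_solution - /(_ rat (fun e D => #|D :&: b e|%:R)).
case=> mu [mu_out [e0 mu_e0] mu_eq].
pose v e := if e \in S then \sum_e' mu e' * (e \in b e')%:R else 0.
pose h := \sum_e' mu e'.
have vD D : D \in A -> \sum_(e in D) v e = \sum_e' mu e' * #|D :&: b e'|%:R.
  move=> DA; transitivity (\sum_(e in D) \sum_e' mu e' * (e \in b e')%:R).
    by apply: eq_bigr => e eD; rewrite /v (fintype.subsetP (AS DA)).
  rewrite exchange_big; apply: eq_bigr => e' _ /=.
  by rewrite -mulr_sumr sum_indicator.
have vD1 D : D \in A -> j \notin D -> \sum_(e in D) v e = h.
  move=> DA jD; rewrite vD //; apply: eq_bigr => e _.
  by have [eC|/mu_out->] := boolP (e \in C); rewrite ?mul0r // bD ?mulr1.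
have vD0 D : D \in A -> j \in D -> \sum_(e in D) v e = 0.
  by move=> DA jD; rewrite vD //; apply: mu_eq; rewrite inE DA.
have vj : v j = h.
  by rewrite /v jS; apply: eq_bigr => e _; rewrite /b !inE eqxx mulr1.
have vx e : v e - h * (x e - (e == j)%:R) = 0.
  apply: (A_sep (d := fun e => v e - h * (x e - (e == j)%:R))) => [e' e'S|D DA].
    rewrite /v (negbTE e'S) x_out //.
    case: eqP => [ej|]; last by rewrite subr0 mulr0 subr0.
    by rewrite -ej (negbTE e'S) in jS.
  rewrite sumrB -mulr_sumr sumrB A_tight //.
  have -> : \sum_(e in D) (e == j)%:R = (j \in D)%:R :> rat.
    have [jD|jD] := boolP (j \in D).
      by rewrite (bigD1 j) //= eqxx big1 ?addr0 // => ? /andP[_ /negbTE->].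
    by rewrite big1 // => ? eD; case: eqP => // ej; rewrite -ej eD in jD.
  have [jD|jD] := boolP (j \in D); first by rewrite vD0 // subrr mulr0 subr0.
  by rewrite vD1 // subr0 mulr1 subrr.
have xj_le1 : x j <= 1.
  have [D DA jD] := A_col jS.
  by rewrite -(A_tight DA) (bigD1 j) //= lerDl sumr_ge0.
(* at j the identity vx reads h = h * (x j - 1), and x j <= 1 *)
have h0 : h = 0.
  have := vx j; rewrite vj eqxx /= => E.
  have /eqP : h * (2 - x j) = 0 by rewrite -[RHS]E; ring.
  by rewrite mulf_eq0 => /orP[/eqP//|/eqP E2]; lra.
have v0 e : v e = 0 by have := vx e; rewrite h0 mul0r subr0.
have e0C : e0 \in C by apply: contraT => /mu_out E; rewrite E eqxx in mu_e0.
have := v0 e0; rewrite /v (fintype.subsetP (AS CA)) //.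
rewrite (bigD1 e0) //= big1 => [|e ee0].
  have [_ e0b] := svalP (selB e0) e0C.
  by rewrite addr0 !inE e0b orbT mulr1 => E; rewrite E eqxx in mu_e0.
have [eC|/mu_out->] := boolP (e \in C); last by rewrite mul0r.
have /eqP/cards1P[z Cb] := bD e C eC CA jC.
have [_ eb] := svalP (selB e) eC.
have : e \in C :&: b e by apply/setIP; split=> //; rewrite !inE eb orbT.
rewrite Cb inE => /eqP ez.
have : e0 \notin C :&: b e by rewrite Cb inE -ez eq_sym.
by rewrite finset.in_setI e0C /= => /negbTE->; rewrite mulr0.
Qed.

(** The de Bruijn-Erdos weights: if every member missing j had the size r of the
    column of j, the #|S| - r members missing j would have total weight 1. *)
Let c (C : {set T}) : rat := if C \in A then (#|S| - #|C|)%N%:R^-1 else 0.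
Let Tc : rat := \sum_C c C.

Let c_gt0 C : C \in A -> 0 < c C.
Proof. by move=> CA; rewrite /c CA invr_gt0 ltr0n subn_gt0 row_not_full. Qed.

Let c_ge0 C : 0 <= c C.
Proof. by rewrite /c; case: ifP => // _; rewrite invr_ge0 ler0n. Qed.

(** Each column sum is at least Tc - 1 by [row_le_column], and the sum of all the
    column sums is exactly #|S| times Tc - 1. *)
Lemma load_row_weights j : j \in S -> load c j = Tc - 1.
Proof.
have lb k : k \in S -> Tc - 1 <= load c k.
  move=> kS; rewrite /Tc (bigID (fun C : {set T} => k \in C)) /= -/(load c k).
  rewrite -addrA gerDl subr_le0.
  pose Z := A :\: [set D in A | k \in D]%SET.
  have Zgt0 : (0 < #|Z|)%N.
    have [C CA kC] := column_not_full kS.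
    by apply/card_gt0P; exists C; rewrite !inE CA kC.
  apply: (@le_trans _ _ (\sum_(C in Z) #|Z|%:R^-1)); last first.
    by rewrite sumr_const -[leLHS]mulr_natl divff // pnatr_eq0 -lt0n.
  rewrite [leLHS]big_mkcond [leRHS]big_mkcond; apply: ler_sum => C _ /=.
  have [kC|kC] := boolP (k \in C); first by case: ifP => // _; rewrite invr_ge0 ler0n.
  have [CA|CA] := boolP (C \in A); last first.
    by rewrite /c (negbTE CA); case: ifP; rewrite // invr_ge0 ler0n.
  rewrite /c CA !inE CA (negbTE kC) /= lef_pV2 ?posrE ?ltr0n ?subn_gt0 ?row_not_full //.
  rewrite ler_nat -cardA /Z cardsD (finset.setIidPr _).
    exact/leq_sub2l/row_le_column.
  by apply/fintype.subsetP => D; rewrite inE => /andP[].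
have sum_eq : \sum_(k in S) (load c k - (Tc - 1)) = 0.
  rewrite sumrB sum_load_in sumr_const -[X in _ - X]mulr_natl.
  transitivity (\sum_C (#|S|%:R * c C - (C \in A)%:R) - #|S|%:R * (Tc - 1)).
    congr (_ - _); apply: eq_bigr => C _; rewrite /c.
    case: ifP => CA; last by rewrite mulr0 mul0r subr0.
    have pS : (#|C| < #|S|)%N by apply: row_not_full.
    rewrite (finset.setIidPl (AS CA)) natrB 1?ltnW // .
    have : (#|C|%:R < #|S|%:R :> rat) by rewrite ltr_nat.
    by move=> ltp /=; field; lra.
  rewrite sumrB -mulr_sumr -/Tc.
  have -> : \sum_C (C \in A)%:R = #|S|%:R :> rat.
    rewrite -cardA -sum1_card natr_sum [RHS]big_mkcond.
    by apply: eq_bigr => C _; case: (C \in A).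
  ring.
move=> jS; move/eqP: sum_eq; rewrite psumr_eq0 => [/allP/(_ j (mem_index_enum j))|k kS].
  by rewrite jS subr_eq0 => /eqP.
by rewrite subr_ge0 lb.
Qed.

Let S_gt0 : exists e, e \in S.
Proof.
apply/existsP; apply: contraT; rewrite negb_exists => /forallP Se.
have : hits F finset.set0.
  apply/hitsP => C CF; have := x_ge1 CF; rewrite big1 ?ler10 // => e eC.
  by have := fintype.subsetP (FS CF) e eC; rewrite (negbTE (Se e)).
by move/w_hits; rewrite big1 ?ler10 // => e; rewrite inE.
Qed.

Let Tc_gt1 : 0 < Tc - 1.
Proof.
have [e eS] := S_gt0; rewrite -(load_row_weights eS).
have [D DA eD] := A_col eS.
rewrite /load (bigD1 D) //= ltr_wpDr ?c_gt0 //.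
by apply: sumr_ge0.
Qed.

Let hits_weight B : hits F B -> Tc < (Tc - 1) * #|S :&: B|%:R.
Proof.
move=> FB; have -> : (Tc - 1) * #|S :&: B|%:R = \sum_(e in S :&: B) load c e.
  rewrite (eq_bigr (fun=> Tc - 1)) => [|e /setIP[eS _]]; last exact: load_row_weights.
  by rewrite sumr_const mulr_natr.
rewrite sum_load_in; have [C CA CB] := tight_row_overhit FB.
have hit D : D \in A -> (0 < #|D :&: (S :&: B)|)%N.
  move=> DA; have [e eD eB] := hitsP _ _ FB D (fintype.subsetP AF _ DA).
  by apply/card_gt0P; exists e; rewrite !inE eD eB (fintype.subsetP (AS DA)).
rewrite /Tc (bigD1 C) //= [ltRHS](bigD1 C) //=; apply: ltr_leD.
  by rewrite ltr_pMr ?c_gt0 // ltr1n finset.setIA (finset.setIidPl (AS CA)).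
apply: ler_sum => D _; have [DA|DA] := boolP (D \in A).
  by rewrite ler_peMr // ler1n hit.
by rewrite /c (negbTE DA) mul0r.
Qed.

(** The indicator of S is, up to the factor Tc - 1, the positive combination with
    weights c of members tight at x, and some member is met twice by B. *)
Lemma minimally_nonideal_cover B : hits F B -> \sum_e x e < #|S :&: B|%:R.
Proof.
move=> /hits_weight; suff E : Tc = (Tc - 1) * \sum_e x e.
  by rewrite {1}E ltr_pM2l.
transitivity (\sum_e x e * load c e).
  rewrite sum_load; apply: eq_bigr => C _; rewrite /c.
  by have [CA|CA] := boolP (C \in A); rewrite ?mul0r // A_tight ?mulr1.
rewrite mulr_sumr; apply: eq_bigr => e _.
have [/load_row_weights->|/x_out->] := boolP (e \in S); first exact: mulrC.
by rewrite mul0r mulr0.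
Qed.

(** A singleton {f} would be the only tight member containing f, which makes Tc - 1
    equal to 1 / (#|S| - 1), against [hits_weight] for the cover S. *)
Lemma minimally_nonideal_no_singleton f : [set f]%SET \notin F.
Proof.
apply/negP => fF; have fS : f \in S.
  by apply: (fintype.subsetP (FS fF)); rewrite inE.
have xf : 1 <= x f by have := x_ge1 fF; rewrite big_set1.
have fA D : D \in A -> f \in D -> D = [set f]%SET.
  move=> DA fD; apply/setP => e; rewrite inE; have [->//|ef] := eqVneq e f.
  apply/negP => eD; have := A_tight DA; rewrite (bigD1 f) //= (bigD1 e) /= ?eD //.
  have : 0 < x e by apply: x_gt0; apply: (fintype.subsetP (AS DA)).
  have : 0 <= \sum_(i in D | (i != f) && (i != e)) x i by apply: sumr_ge0.
  under [X in 0 <= X]eq_bigl do rewrite andbA.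
  by lra.
have [D DA fD] := A_col fS; have Df := fA D DA fD.
have lf : load c f = c D.
  rewrite /load (bigD1 D) //= big1 ?addr0 // => E /andP[fE ED].
  rewrite /c; case: ifP => // EA; by rewrite (fA E EA fE) -Df eqxx in ED.
have n1 : (#|D| < #|S|)%N by apply: row_not_full.
have : hits F S.
  apply/hitsP => C CF; apply/exists_inP; apply: contraT.
  rewrite negb_exists_in => /forall_inP Ce.
  have := x_ge1 CF; rewrite big1 ?ler10 // => e eC.
  by have := Ce e eC; rewrite (fintype.subsetP (FS CF)).
move/hits_weight; rewrite finset.setIid.
have := load_row_weights fS; rewrite lf /c DA Df cards1 => E.
rewrite Df cards1 in n1.
have n1' : 1 < #|S|%:R :> rat by rewrite ltr1n.
rewrite natrB 1?ltnW // in E.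
have -> : Tc = 1 + (#|S|%:R - 1)^-1 by rewrite E; ring.
have <- : 1 + (#|S|%:R - 1)^-1 = (1 + (#|S|%:R - 1)^-1 - 1) * #|S|%:R :> rat.
  by field; lra.
by rewrite ltxx.
Qed.

End MinimallyNonideal.

(** Induction on the ground set S. A family whose proper minors are ideal while it is
    not has only covers larger than x(S), whereas at most x(S) members are
    disjoint. If the smallest cover size is at most uphalf #|S| this contradicts
    the hypothesis at that size; otherwise uphalf #|S| disjoint members avoid a
    chosen element e, too many for sets of size at least 2. *)
Lemma ideal_of_packs_at (T : finType) (F : {set {set T}}) (S : {set T}) :
  (forall C, C \in F -> C \subset S) ->
  (forall k, (k <= uphalf #|S|)%N -> packs_at F k) -> ideal_family F.
Proof.
move: {2}#|S| (erefl #|S|) => n; elim: n F S => [|n IHn] F S Sn FS Fpack.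
  move=> w x w0 wF x0 xF; have S0 : S = finset.set0 by apply/eqP; rewrite -cards_eq0 Sn.
  have := wF finset.set0; rewrite big1 ?ler10 => [|e]; last by rewrite inE.
  suff -> : hits F finset.set0 by move=> /(_ isT).
  apply/hitsP => C CF; have := xF C CF; have := FS C CF.
  by rewrite S0 finset.subset0 => /eqP->; rewrite big1 ?ler10 // => e; rewrite inE.
have minor j : j \in S -> #|S :\ j| = n.
  by move=> jS; have := cardsD1 j S; rewrite jS Sn => -[].
have Fpack' k : (k <= uphalf n)%N -> packs_at F k.
  by move=> kn; apply: Fpack; apply: leq_trans kn _; rewrite Sn; lia.
have ideal_del j : j \in S -> ideal_family (deletion F j).
  move=> jS; apply: (IHn _ (S :\ j)) => [|C|k]; rewrite ?minor //.
    rewrite inE => /andP[CF jC]; apply/fintype.subsetP => e eC.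
    rewrite !inE (fintype.subsetP (FS C CF)) // andbT.
    by apply: contraNneq jC => <-.
  by move=> kn; apply/deletion_packs_at/Fpack'.
have ideal_con j : j \in S -> ideal_family (contraction F j).
  move=> jS; apply: (IHn _ (S :\ j)) => [|_ /imsetP[C CF ->]|k]; rewrite ?minor //.
    exact/finset.setSD/FS.
  by move=> kn; apply/contraction_packs_at/Fpack'.
move=> w x0 w0 wF x00 x0F; rewrite leNgt; apply/negP => wx0.
have [x [[x_ge0 x_out x_ge1 wx] x_sep]] := vertex_below_one FS w0 x00 x0F wx0.
have x_gt0 e : e \in S -> 0 < x e.
  move=> eS; rewrite lt0r x_ge0 andbT; apply/negP => /eqP xe.
  move: wx; rewrite ltNge => /negP[]; apply: (ideal_con e eS) => //.
    move=> B FB; apply: (@le_trans _ _ (\sum_(e' in B :\ e) w e')).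
      apply: wF; apply/hitsP => C CF.
      have [e' + e'B] := hitsP _ _ FB (C :\ e) (imset_f _ CF).
      by rewrite !inE => /andP[e'e e'C]; exists e'; rewrite // !inE e'e.
    rewrite [leLHS]big_mkcond [leRHS]big_mkcond; apply: ler_sum => e' _ /=.
    by rewrite !inE; case: eqP => //= _; case: ifP.
  move=> _ /imsetP[C CF ->]; apply: le_trans (x_ge1 C CF) _.
  rewrite [leLHS]big_mkcond [leRHS]big_mkcond; apply: ler_sum => e' _ /=.
  by rewrite !inE; case: eqP => //= ->; rewrite xe; case: ifP.
pose U := [set C in F | \sum_(e in C) x e == 1]%SET.
have [d dS dU|A [AU cardA A_sep]] := @separating_basis T S U.
  apply: x_sep => [C CF xC|e xe]; first by apply: dU; rewrite inE CF xC eqxx.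
  by apply: dS; apply/negP => /x_gt0; rewrite xe ltxx.
have AF : A \subset F.
  apply: fintype.subset_trans AU _; apply/fintype.subsetP => C.
  by rewrite inE => /andP[].
have A_tight C : C \in A -> \sum_(e in C) x e = 1.
  by move=> /(fintype.subsetP AU); rewrite inE => /andP[_ /eqP].
have coverS := minimally_nonideal_cover FS wF x_gt0 x_out x_ge1 wx AF A_tight
  cardA A_sep ideal_del.
have noS := minimally_nonideal_no_singleton FS wF x_gt0 x_out x_ge1 wx AF A_tight
  cardA A_sep ideal_del.
have size2 C : C \in F -> (2 <= #|C|)%N.
  move=> CF; rewrite ltn_neqAle; apply/andP; split.
    rewrite eq_sym; apply/negP => /cards1P[f Cf].
    by have := noS f; rewrite -Cf CF.
  rewrite lt0n cards_eq0; apply/negP => /eqP C0.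
  by have := x_ge1 C CF; rewrite C0 big1 ?ler10 // => e; rewrite inE.
pose one (D : {set T}) (e : T) : nat := (e \in D).
have oneE (D B : {set T}) : (\sum_(e in B) one D e = #|D :&: B|)%N.
  rewrite -sum1_card big_mkcond [RHS]big_mkcond /=.
  by apply: eq_bigr => e _; rewrite /one inE; case: (e \in D); case: (e \in B).
have hitsS : hits F S.
  apply/hitsP => C CF; have /card_gt0P[e eC] : (0 < #|C|)%N by apply: ltnW (size2 C CF).
  by exists e; rewrite // (fintype.subsetP (FS C CF)).
case: (@arg_minnP _ S (hits F) (fun B => #|S :&: B|) hitsS) => B FB minB.
have [small|large] := leqP #|S :&: B| (uphalf n.+1).
  have : pack F (one S) #|S :&: B|.
    by apply: Fpack => [|B' FB']; rewrite ?Sn // oneE minB.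
  move=> /pack_weight - /(_ x 1 x_ge0 x_ge1); rewrite mul1r leNgt => /negP[].
  apply: le_lt_trans (coverS B FB); apply: ler_sum => e _.
  by rewrite ler_piMr // /one lern1 leq_b1.
have [e eS] : exists e, e \in S by apply/card_gt0P; rewrite Sn.
have : pack F (one (S :\ e)) (uphalf n.+1).
  apply: Fpack => [|B' FB']; rewrite ?Sn // oneE.
  have := leq_trans large (minB B' FB').
  rewrite (cardsD1 e (S :&: B')) => H; rewrite -ltnS; apply: leq_trans H _.
  rewrite -[X in (_ <= X)%N]add1n leq_add ?leq_b1 //.
  by apply/subset_leq_card/fintype.subsetP => e'; rewrite !inE andbA.
move=> packe.
have : 2%:R * (uphalf n.+1)%:R <= \sum_e' 1 * (one (S :\ e) e')%:R :> rat.
  by apply: (pack_weight packe) => // C CF; rewrite sumr_const ler_nat size2.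
under eq_bigr do rewrite mul1r.
rewrite -natr_sum -natrM ler_nat.
have := oneE (S :\ e) [set: T]%SET; rewrite finset.setIT minor //.
rewrite (eq_bigl xpredT) => [->|e']; last by rewrite inE.
by lia.
Qed.

(** * The least failure of an ideal family *)

(** In the borderline case k = (b - 1)^2, and k > n / 2 rules out b <= 2. *)
Lemma square_side_lt b n k :
  (b * b <= n)%N -> (uphalf n < k)%N -> (k + b + b = (b * b).+1)%N -> (b < k)%N.
Proof.
move=> bn nk kb; rewrite ltnNge; apply/negP => le_kb.
have b2 : (b <= 2)%N by rewrite leqNgt; apply/negP => b3; nia.
by case: b b2 bn kb le_kb => [|[|[|]]] //; lia.
Qed.

(** Since (d + b)^2 >= 4 d b >= 4 s, strictly when d and b differ, the bound
    4 s + 1 fails only in the excluded case; it then passes from s to any larger n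
    because the square grows faster than 4 n. *)
Lemma sqrn_gap s d b q n :
  (s <= n)%N -> (s <= d * b)%N -> (0 < d)%N -> (0 < b)%N ->
  ~ (s = d * b /\ d = b /\ q = 0)%N ->
  (4 * n + 1 <= (d + b + q + (n - s)) ^ 2)%N.
Proof.
move=> sn sdb d0 b0 neq.
have gap : (4 * s + 1 <= (d + b + q) ^ 2)%N.
  have ge4 : (4 * (d * b) + (d != b) <= (d + b) ^ 2)%N.
    have [-> /=|] := eqVneq d b; first by rewrite addn0 -mulnn; lia.
    rewrite neq_ltn => /orP[lt|lt] /=.
      have [r ->] : exists r, b = (d + 1 + r)%N by exists (b - d - 1)%N; lia.
      by rewrite -mulnn; nia.
    have [r ->] : exists r, d = (b + 1 + r)%N by exists (d - b - 1)%N; lia.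
    by rewrite -mulnn; nia.
  have qq : ((d + b) ^ 2 + q <= (d + b + q) ^ 2)%N by rewrite -!mulnn; nia.
  move: ((d + b) ^ 2)%N ge4 qq => u ge4 qq.
  by move: (d * b)%N sdb neq ge4 => v; lia.
have : (2 <= d + b + q)%N by lia.
move: (d + b + q)%N gap => t gap t2.
have [r ->] : exists r, n = (s + r)%N by exists (n - s)%N; lia.
rewrite addKn; apply: leq_trans (_ : t ^ 2 + 4 * r <= _)%N; first lia.
have : (2 * r <= t * r)%N by rewrite leq_mul2r t2 orbT.
by rewrite sqrnD; lia.
Qed.

(** The situation of a least failure: k is the least integer at which the min-max
    equality fails, w a minimal capacity on which it fails there. Minimality of w
    puts every element of its support S in a tight cover. *)
Section MinimalFailure.

Variables (T : finType) (F : {set {set T}}) (w : T -> nat) (k : nat).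

Let tight (B : {set T}) := hits F B && (\sum_(e in B) w e == k)%N.

Hypothesis idealF : ideal_family F.
Hypothesis k_gt0 : (0 < k)%N.
Hypothesis packF : forall i, (i < k)%N -> packs_at F i.
Hypothesis w_hits : forall B, hits F B -> (k <= \sum_(e in B) w e)%N.
Hypothesis nopack : ~ pack F w k.
Hypothesis w_tight : forall e, (0 < w e)%N -> exists2 B, tight B & e \in B.

Let S := [set e | (0 < w e)%N]%SET.

Definition optimal (lam : {set T} -> rat) : Prop :=
  [/\ forall C, 0 <= lam C, forall C, C \notin F -> lam C = 0,
      \sum_C lam C = k%:R & forall e, load lam e <= (w e)%:R].

(** Linear independence of the incidence vectors of the support of lam. *)
Definition independent (lam : {set T} -> rat) : Prop :=
  forall mu : {set T} -> rat, (forall C, lam C = 0 -> mu C = 0) ->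
    (forall e, load mu e = 0) -> forall C, mu C = 0.

Lemma optimal_exists : exists lam, optimal lam.
Proof.
have k0 : 0 < k%:R :> rat by rewrite ltr0n.
have [e|x x0 xF|lam [lam0 lamF lam1 lamw]] :=
    @fractional_packing T F (fun e => (w e)%:R / k%:R).
- by rewrite divr_ge0.
- apply: idealF => // [e|B FB]; first by rewrite divr_ge0.
  by rewrite -mulr_suml ler_pdivlMr // mul1r -natr_sum ler_nat w_hits.
exists (fun C => lam C * k%:R); split.
- by move=> C; rewrite mulr_ge0.
- by move=> C /lamF->; rewrite mul0r.
- by rewrite -mulr_suml lam1 mul1r.
- by move=> e; rewrite /load -mulr_suml -ler_pdivlMr // lamw.
Qed.

Lemma S_nonempty : exists e, e \in S.
Proof.
have [F0|F0] := boolP (finset.set0 \in F).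
  case: nopack; exists (fun=> finset.set0); split=> // e.
  by rewrite big1 // => i; rewrite inE.
have : hits F [set: T]%SET.
  apply/hitsP => C CF.
  have /set0Pn[e eC] : C != finset.set0 by apply: contraNneq F0 => <-.
  by exists e; rewrite ?inE.
move/w_hits => kw; apply/existsP; apply: contraT; rewrite negb_exists => /forallP Se.
move: kw; rewrite big1 => [|e _]; first by rewrite leqNgt k_gt0.
by have := Se e; rewrite inE -eqn0Ngt => /eqP.
Qed.

Section Optimal.

Variable lam : {set T} -> rat.
Hypothesis opt : optimal lam.

Lemma optimal_tight B : tight B ->
  (forall e, e \in B -> load lam e = (w e)%:R) /\
  (forall C, lam C != 0 -> #|C :&: B| = 1%N).
Proof.
case: opt => lam0 lamF lamk lamw /andP[FB /eqP wB].
apply: complementary_slackness => // [C lC|]; last by rewrite -natr_sum wB lamk.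
have CF : C \in F by apply: contraNT lC => /lamF->.
have [e eC eB] := hitsP _ _ FB C CF.
by apply/card_gt0P; exists e; rewrite inE eC.
Qed.

Lemma optimal_load e : load lam e = (w e)%:R.
Proof.
have [/w_tight[B /optimal_tight[H _] /H//]|] := boolP (0 < w e)%N.
case: opt => lam0 _ _ lamw; rewrite -eqn0Ngt => /eqP we.
by apply: le_anti; rewrite lamw we sumr_ge0.
Qed.

Lemma le_load (C : {set T}) e : e \in C -> lam C <= load lam e.
Proof.
case: opt => lam0 _ _ _ eC; rewrite /load (bigD1 C) //= lerDl.
exact: sumr_ge0.
Qed.

Lemma optimal_sub C : lam C != 0 -> C \subset S.
Proof.
move=> lC; apply/fintype.subsetP => e /le_load; rewrite optimal_load inE.
case: opt => lam0 _ _ _; rewrite lt0n => H; apply: contraNneq lC => we.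
by rewrite we in H; rewrite eq_le H lam0.
Qed.

(** If C had weight at least 1, the remaining capacities would have covering value
    k - 1, so k - 1 members could be packed there and C added to them. *)
Lemma optimal_lt1 C : lam C < 1.
Proof.
case: opt => lam0 lamF lamk lamw; rewrite ltNge; apply/negP => lC.
have CF : C \in F.
  by apply: contraT => /lamF E; rewrite E ler10 in lC.
have wC e : e \in C -> (0 < w e)%N.
  move=> eC; rewrite -(ltr_nat rat); apply: lt_le_trans ltr01 _.
  by apply: le_trans lC _; apply: le_trans (le_load eC) _.
have [k' kE] : exists k', k = k'.+1 by exists k.-1; rewrite prednK.
have [|B FB|g [gF gw]] := packF (i := k') _ (w := fun e => (w e - (e \in C))%N).
- by rewrite kE.
- rewrite -(ler_nat rat) natr_sum.
  have -> : \sum_(e in B) (w e - (e \in C))%N%:R =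
      \sum_(e in B) ((w e)%:R - (e \in C)%:R) :> rat.
    apply: eq_bigr => e _; rewrite natrB //.
    by case: (boolP (e \in C)) => // /wC.
  have hitC D : D \in F -> (0 < #|D :&: B|)%N.
    move=> DF; have [e eD eB] := hitsP _ _ FB D DF.
    by apply/card_gt0P; exists e; rewrite inE eD.
  have CB1 : 1 <= #|C :&: B|%:R :> rat by rewrite ler1n hitC.
  rewrite sumrB sum_indicator finset.setIC.
  have : \sum_(e in B) load lam e <= \sum_(e in B) (w e)%:R.
    by apply: ler_sum => e _.
  rewrite sum_load_in (bigD1 C) //=.
  have : \sum_(D | D != C) lam D <= \sum_(D | D != C) lam D * #|D :&: B|%:R.
    apply: ler_sum => D _; have [DF|/lamF->] := boolP (D \in F); last by rewrite mul0r.
    by rewrite ler_peMr // ler1n hitC.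
  have : \sum_D lam D = k'%:R + 1 by rewrite lamk kE -natr1.
  rewrite (bigD1 C) //=.
  have : 0 <= (lam C - 1) * (#|C :&: B|%:R - 1) by rewrite mulr_ge0 // subr_ge0.
  by lra.
case: nopack; rewrite kE.
exists (fun i => if unlift ord0 i is Some j then g j else C); split.
  by move=> i; case: unliftP => [j|] _.
move=> e; rewrite big_ord_recl unlift_none.
under eq_bigr do rewrite liftK.
apply: leq_trans (_ : (e \in C) + (w e - (e \in C)) <= _)%N; first by rewrite leq_add2l.
by rewrite subnKC //; case: (boolP (e \in C)) => // /wC.
Qed.

Let chi (C : {set T}) : rat := (lam C != 0)%:R.

(** The number of sets of the support containing e is an integer larger than w e,
    because all the weights are below 1. *)
Lemma load_support e : e \in S -> (w e)%:R + 1 <= load chi e.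
Proof.
case: opt => lam0 lamF lamk lamw eS.
have -> : load chi e = #|[set C : {set T} | (e \in C) && (lam C != 0)]%SET|%:R.
  rewrite -sum1_card natr_sum /load big_mkcond [RHS]big_mkcond.
  by apply: eq_bigr => C _; rewrite /chi inE /=; case: (e \in C); case: eqP.
rewrite natr1 ler_nat -(ltr_nat rat) -optimal_load -sum1_card natr_sum /load.
rewrite big_mkcond [ltRHS]big_mkcond.
have [C eC lC] : exists2 C : {set T}, e \in C & lam C != 0.
  have [[C eC lC]|noC] :=
    pselect (exists2 C : {set T}, e \in C & lam C != 0); first by exists C.
  move: eS; rewrite inE -(ltr_nat rat) -optimal_load /load big1 ?ltxx // => C eC.
  by apply/eqP; apply: contraT => lC; case: noC; exists C.
rewrite (bigD1 C) //= [ltRHS](bigD1 C) //= inE eC lC /=.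
apply: ltr_leD; first exact: optimal_lt1.
apply: ler_sum => D _; rewrite inE; case: (e \in D) => //=.
by have [->|] := eqVneq (lam D) 0; rewrite //= ltW // optimal_lt1.
Qed.

Lemma load_support_out e : e \notin S -> load chi e = 0.
Proof.
move=> eS; rewrite /load big1 // => C eC; rewrite /chi.
have [//|/optimal_sub/fintype.subsetP/(_ _ eC)] := eqVneq (lam C) 0.
by rewrite (negbTE eS).
Qed.

Lemma support_weight B : tight B ->
  \sum_(e in B) load chi e = #|[set C | lam C != 0]%SET|%:R.
Proof.
move=> tB; have [_ H] := optimal_tight tB.
rewrite sum_load_in -sum1_card natr_sum [RHS]big_mkcond; apply: eq_bigr => C _.
by rewrite inE /chi; have [_|/H->] := eqVneq (lam C) 0; rewrite ?mul0r ?mulr1.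
Qed.

Let weight1 B : tight B ->
  \sum_(e in B) ((w e)%:R + (e \in S)%:R) = (k + #|B :&: S|)%:R :> rat.
Proof.
by move=> /andP[_ /eqP wB]; rewrite big_split /= sum_indicator -natr_sum wB natrD.
Qed.

Let load_support_all e : (w e)%:R + (e \in S)%:R <= load chi e.
Proof.
have [/load_support//|eS] := boolP (e \in S).
rewrite load_support_out //; move: eS; rewrite inE -eqn0Ngt => /eqP->.
by rewrite addr0.
Qed.

Lemma support_ge B : tight B -> (k + #|B :&: S| <= #|[set C | lam C != 0%R]%SET|)%N.
Proof.
move=> tB; rewrite -(ler_nat rat) -(support_weight tB) -(weight1 tB).
exact: ler_sum.
Qed.

Lemma support_eq B e : tight B -> e \in B -> e \in S ->
  (#|[set C | lam C != 0%R]%SET| <= k + #|B :&: S|)%N -> load chi e = (w e)%:R + 1.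
Proof.
move=> tB eB eS; rewrite -(ler_nat rat) -(support_weight tB) -(weight1 tB) => le.
have E : \sum_(e in B) (load chi e - ((w e)%:R + (e \in S)%:R)) = 0.
  apply: le_anti; rewrite sumrB subr_le0 le -sumrB /=.
  by apply: sumr_ge0 => e' _; rewrite subr_ge0.
move/eqP: E; rewrite psumr_eq0 => [/allP/(_ e (mem_index_enum e))|? _].
  by rewrite eB eS subr_eq0 => /eqP.
by rewrite subr_ge0.
Qed.

(** Moving along a linear dependency keeps the packing optimal until the first
    weight reaches 0. *)
Lemma optimal_push (mu : {set T} -> rat) :
  (forall C, mu C != 0 -> C \in F) -> (forall C, mu C < 0 -> 0 < lam C) ->
  (forall e, load mu e = 0) -> \sum_C mu C = 0 -> (exists C, mu C < 0) ->
  exists2 lam' : {set T} -> rat, optimal lam' & exists C0,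
    [/\ mu C0 < 0, lam' C0 = 0 & forall C, lam C = 0 -> mu C = 0 -> lam' C = 0].
Proof.
case: opt => lam0 lamF lamk lamw muF mulam mul mu0 [C1 muC1].
pose ratio C := lam C / - mu C.
case: (@arg_minP _ _ _ C1 (fun C => mu C < 0) ratio muC1) => C0 muC0 minC0.
set t := ratio C0 in minC0.
have t0 : 0 <= t by rewrite divr_ge0 // oppr_ge0 ltW.
exists (fun C => lam C + t * mu C).
  split.
  - move=> C; have [muC|muC] := leP 0 (mu C).
      by rewrite addr_ge0 // mulr_ge0.
    by have := minC0 C muC; rewrite /ratio ler_pdivlMr ?oppr_gt0 //; lra.
  - move=> C CF; rewrite lamF // add0r; have [->|/muF] := eqVneq (mu C) 0.
      by rewrite mulr0.
    by rewrite (negbTE CF).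
  - by rewrite big_split /= -mulr_sumr mu0 mulr0 addr0.
  - move=> e; rewrite /load big_split /= -mulr_sumr -/(load mu e) mul mulr0 addr0.
    exact: lamw.
exists C0; split=> //.
  by rewrite /t /ratio; field; rewrite lt_eqF.
by move=> C -> ->; rewrite mulr0 addr0.
Qed.

End Optimal.

Lemma sum_eq0_of_load (mu : {set T} -> rat) (B : {set T}) :
  (forall C, mu C != 0 -> #|C :&: B| = 1%N) -> (forall e, load mu e = 0) ->
  \sum_C mu C = 0.
Proof.
move=> muB mu0; transitivity (\sum_C mu C * #|C :&: B|%:R).
  by apply: eq_bigr => C _; have [->|/muB->] := eqVneq (mu C) 0; rewrite ?mul0r ?mulr1.
by rewrite -sum_load_in big1.
Qed.

Let tight_exists : exists B, tight B.
Proof. by have [e] := S_nonempty; rewrite inE => /w_tight[B tB _]; exists B. Qed.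

Lemma sum0_has_neg (mu : {set T} -> rat) (C : {set T}) :
  \sum_C mu C = 0 -> mu C != 0 -> exists D, mu D < 0.
Proof.
move=> mu0 muC; have [//|noD] := pselect (exists D, mu D < 0).
have mu_ge0 D : 0 <= mu D by rewrite leNgt; apply/negP => ?; apply: noD; exists D.
move/eqP: mu0; rewrite psumr_eq0 // => /allP/(_ C (mem_index_enum C)).
by rewrite (negbTE muC).
Qed.

(** Caratheodory: push along dependencies of the support until there are none. *)
Lemma optimal_reduce lam : optimal lam ->
  exists lam', [/\ optimal lam', independent lam' &
    forall C, lam C = 0 -> lam' C = 0].
Proof.
have [m] := ubnP #|[set C | lam C != 0]%SET|; elim: m lam => // m IHm lam.
rewrite ltnS => lem opt; have [ind|] := pselect (independent lam); first by exists lam.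
move=> /existsNP[mu /not_implyP[mulam /not_implyP[mul /existsNP[C /eqP muC]]]].
have [B tB] := tight_exists; have [_ lamB] := optimal_tight opt tB.
have nz D : mu D != 0 -> lam D != 0 by apply: contraNneq => /mulam->.
have mu0 : \sum_C mu C = 0 by apply: (@sum_eq0_of_load _ B) => // D /nz/lamB.
case: (opt) => lam0 lamF lamk lamw.
have [||//|//||lam' opt' [C0 [muC0 lamC0 lam'0]]] := optimal_push opt (mu := mu).
- by move=> D /nz; apply: contraNT => /lamF->.
- by move=> D muD; rewrite lt0r lam0 andbT nz // lt_eqF.
- exact: sum0_has_neg muC.
have [|lam'' [opt'' ind'' sub'']] := IHm lam' _ opt'.
  apply: leq_trans lem; apply/proper_card/properP; split.
    apply/fintype.subsetP => D; rewrite !inE; apply: contraNneq => lD.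
    by rewrite lam'0 // mulam.
  by exists C0; [rewrite inE nz // lt_eqF|rewrite inE lamC0 eqxx].
exists lam''; split=> // D lD; apply: sub''; apply: lam'0 => //; exact: mulam.
Qed.

(** A least family of tight covers exhausting S: each of them has an element of S
    that no other one contains. *)
Lemma tight_cover_family : exists Bs : {set {set T}},
  [/\ forall B, B \in Bs -> tight B, S \subset finset.cover Bs &
      forall B, B \in Bs -> exists e, [/\ e \in S, e \in B &
        forall B', B' \in Bs -> e \in B' -> B' = B]].
Proof.
pose P (Bs : {set {set T}}) := [forall B in Bs, tight B] && (S \subset finset.cover Bs).
have P0 : P [set B | tight B]%SET.
  apply/andP; split; first by apply/forall_inP => B; rewrite inE.
  apply/fintype.subsetP => e; rewrite inE => /w_tight[B tB eB].
  by apply/finset.bigcupP; exists B; rewrite ?inE.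
case: (arg_minnP (fun Bs : {set {set T}} => #|Bs|) P0) => Bs.
move=> /andP[/forall_inP tBs covBs] minBs.
exists Bs; split=> // B BBs.
have [[e [eS eB]]|no] := pselect (exists e, e \in S /\ e \notin finset.cover (Bs :\ B)).
  exists e; split=> // [|B' B'Bs eB'].
    have /finset.bigcupP[B' B'Bs eB'] := fintype.subsetP covBs e eS.
    have [<-//|B'B] := eqVneq B' B.
    by case/finset.bigcupP: eB; exists B'; rewrite // !inE B'B.
  apply: contraNeq eB => B'B; apply/finset.bigcupP; exists B' => //.
  by rewrite !inE B'B.
have /minBs : P (Bs :\ B).
  apply/andP; split; first by apply/forall_inP => B' /setD1P[_ /tBs].
  by apply/fintype.subsetP => e eS; apply: contraT => eB; case: no; exists e.
by rewrite (cardsD1 B Bs) BBs add1n ltnn.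
Qed.

(** Sets meeting every cover of Bs exactly once span a space of dimension at most
    #|S| + 1 - #|Bs|. Indeed a combination that vanishes at all elements except the
    private elements of the covers other than B0 has total weight 0, computed
    on B0, and then vanishes at each private element, computed on its cover. *)
Lemma dependent_of_large (Bs Ts : {set {set T}}) :
  S \subset finset.cover Bs ->
  (forall B, B \in Bs -> exists e, [/\ e \in S, e \in B &
     forall B', B' \in Bs -> e \in B' -> B' = B]) ->
  (forall C, C \in Ts -> C \subset S) ->
  (forall C B, C \in Ts -> B \in Bs -> #|C :&: B| = 1%N) ->
  (#|S|.+1 < #|Ts| + #|Bs|)%N ->
  exists mu : {set T} -> rat, [/\ forall C, C \notin Ts -> mu C = 0,
    exists C, mu C != 0 & forall e, load mu e = 0].
Proof.
move=> covBs priv TsS TsB large.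
have [e0 e0S] := S_nonempty.
have /finset.bigcupP[B0 B0Bs _] := fintype.subsetP covBs e0 e0S.
have selp B : {e | B \in Bs -> [/\ e \in S, e \in B &
     forall B', B' \in Bs -> e \in B' -> B' = B]}.
  by apply: cid; have [/priv[e]|] := boolP (B \in Bs); [exists e|exists e0].
pose p B := sval (selp B).
have pP B : B \in Bs -> [/\ p B \in S, p B \in B &
     forall B', B' \in Bs -> p B \in B' -> B' = B] by exact: (svalP (selp B)).
pose Q := [set p B | B in Bs :\ B0]%SET.
have cardQ : #|Q| = #|Bs|.-1.
  rewrite card_in_imset ?(cardsD1 B0 Bs) ?B0Bs // => B B'.
  move=> /setD1P[_ BBs] /setD1P[_ B'Bs] E.
  have [_ pB _] := pP B BBs; have [_ _] := pP B' B'Bs.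
  by apply; rewrite // -E.
have QS : Q \subset S.
  apply/fintype.subsetP => _ /imsetP[B /setD1P[_ BBs] ->]; by case: (pP B BBs).
have [|mu [muTs munz mu0]] :=
    @nonzero_solution rat _ _ Ts (S :\: Q) (fun C e => (e \in C)%:R).
  rewrite cardsD (finset.setIidPr QS) cardQ.
  have : (#|Q| <= #|S|)%N by apply: subset_leq_card.
  have : (0 < #|Bs|)%N by apply/card_gt0P; exists B0.
  rewrite cardQ; lia.
exists mu; split=> //.
have loadE e : load mu e = \sum_C mu C * (e \in C)%:R.
  rewrite /load big_mkcond; apply: eq_bigr => C _.
  by case: (e \in C); rewrite ?mulr1 ?mulr0.
have load_out e : e \notin Q -> load mu e = 0.
  move=> eQ; rewrite loadE; have [eS|eS] := boolP (e \in S).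
    by apply: mu0; rewrite inE eQ.
  rewrite big1 // => C _; have [CTs|/muTs->] := boolP (C \in Ts); last by rewrite mul0r.
  case: (boolP (e \in C)) => [/(fintype.subsetP (TsS C CTs))|]; last by rewrite mulr0.
  by rewrite (negbTE eS).
have sumB B : B \in Bs -> \sum_(e in B) load mu e = \sum_C mu C.
  move=> BBs; rewrite sum_load_in; apply: eq_bigr => C _.
  by have [CTs|/muTs->] := boolP (C \in Ts); rewrite ?mul0r // TsB // mulr1.
have sum0 : \sum_C mu C = 0.
  rewrite -(sumB _ B0Bs) big1 // => e eB0; apply: load_out.
  apply/negP => /imsetP[B /setD1P[BB0 BBs] eB]; have [_ _] := pP B BBs.
  by move=> /(_ B0 B0Bs); rewrite -eB eB0 => /(_ isT) E; rewrite E eqxx in BB0.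
move=> e; have [/imsetP[B /setD1P[BB0 BBs] eB]|/load_out//] := boolP (e \in Q).
have [_ pB _] := pP B BBs.
have := sumB B BBs; rewrite sum0 (bigD1 e) ?eB //= big1 ?addr0 // => e' /andP[e'B e'e].
apply: load_out; apply/negP => /imsetP[B' /setD1P[_ B'Bs] e'B'].
have [_ _ /(_ B BBs)] := pP B' B'Bs; rewrite -e'B' => /(_ e'B) E.
by rewrite e'B' E eqxx in e'e.
Qed.


Let supp (lam : {set T} -> rat) : {set {set T}} := [set C | lam C != 0]%SET.

(** In the borderline case the support of every independent optimal packing has
    the same size and its members sum to w + 1 on S. The complementary weights
    nu = 1 - lam fractionally pack the indicator of S with value m < k, so m members
    pack it integrally, with multiplicities eta. One of these members, C1, is
    outside the support of lam, as otherwise eta = nu would contradict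
    0 < nu < 1. By [dependent_of_large] C1 depends on the support, so pushing
    along the dependency exchanges C1 for some C0. Both supports sum to w + 1,
    hence C0 = C1. *)
Lemma extremal_failure_absurd (Bs : {set {set T}}) (lam : {set T} -> rat) (m : nat) :
  (forall B, B \in Bs -> tight B) -> S \subset finset.cover Bs ->
  (forall B, B \in Bs -> exists e, [/\ e \in S, e \in B &
     forall B', B' \in Bs -> e \in B' -> B' = B]) ->
  (forall B, B \in Bs -> #|B :&: S| = m) ->
  (forall lam, optimal lam -> independent lam -> (#|supp lam| <= k + m)%N) ->
  (k + m + #|Bs| = #|S|.+1)%N -> (m < k)%N ->
  optimal lam -> independent lam -> False.
Proof.
move=> tBs covBs priv BsS suppm kmd mk opt ind.
have [e0 e0S] := S_nonempty.
have [B0 B0Bs _] : exists2 B, B \in Bs & e0 \in B.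
  by have /finset.bigcupP[B BBs e0B] := fintype.subsetP covBs e0 e0S; exists B.
have card_supp l : optimal l -> independent l -> #|supp l| = (k + m)%N.
  move=> ol il; apply/eqP; rewrite eqn_leq suppm //=.
  by rewrite -(BsS B0) // support_ge // tBs.
have load_supp l e : optimal l -> independent l -> e \in S ->
    load (fun C => (l C != 0)%:R) e = (w e)%:R + 1.
  move=> ol il eS.
  have /finset.bigcupP[B BBs eB] := fintype.subsetP covBs e eS.
  by apply: (support_eq ol (tBs B BBs)) => //; rewrite BsS // suppm.
have lamB C B : C \in supp lam -> B \in Bs -> #|C :&: B| = 1%N.
  by rewrite inE => lC /tBs /(optimal_tight opt)[_]; apply.
case: (opt) => lam0 lamF lamk lamw.
(* complementary weights: the sum of the support minus w is 1 on S *)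
pose nu C := (lam C != 0)%:R - lam C.
have nu0 C : 0 <= nu C.
  rewrite /nu; have [->|lC] := eqVneq (lam C) 0; first by rewrite subr0.
  by rewrite subr_ge0 ltW // (optimal_lt1 opt).
have load_nu e : load nu e = (e \in S)%:R.
  rewrite /load sumrB -!/(load _ e) (optimal_load opt).
  have [eS|eS] := boolP (e \in S); first by rewrite load_supp // addrAC subrr add0r.
  rewrite (load_support_out opt) //; move: eS; rewrite inE -eqn0Ngt => /eqP->.
  by rewrite subr0.
have sum_nu : \sum_C nu C = m%:R.
  rewrite sumrB lamk.
  have -> : \sum_C (lam C != 0)%:R = #|supp lam|%:R :> rat.
    rewrite -sum1_card natr_sum [RHS]big_mkcond; apply: eq_bigr => C _.
    by rewrite inE; case: eqP.
  by rewrite card_supp // natrD addrAC subrr add0r.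
have [B FB|g [gF gS]] := packF mk (w := fun e => (e \in S) : nat).
  rewrite -(ler_nat rat) natr_sum -sum_nu.
  under [leRHS]eq_bigr do rewrite -load_nu.
  rewrite sum_load_in; apply: ler_sum => C _.
  have [->|nC] := eqVneq (nu C) 0; first by rewrite mul0r.
  have CF : C \in F.
    by apply: contraNT nC => /lamF E; rewrite /nu E.
  rewrite ler_peMr // ler1n; have [e eC eB] := hitsP _ _ FB C CF.
  by apply/card_gt0P; exists e; rewrite inE eC.
pose eta (C : {set T}) : rat := (\sum_(i < m) (g i == C))%N%:R.
have load_eta e : load eta e = (\sum_(i < m) (e \in g i))%N%:R.
  rewrite /load -natr_sum exchange_big /=; congr _%:R; apply: eq_bigr => i _.
  rewrite -big_mkcondr /= sum1dep_card.
  have [egi|egi] := boolP (e \in g i).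
    rewrite (@eq_card1 _ (g i)) // => C; rewrite !inE andbC eq_sym.
    by case: eqP => // ->.
  rewrite eq_card0 // => C; rewrite !inE; apply/negP => /andP[eC /eqP E].
  by rewrite E eC in egi.
have sum_eta : \sum_C eta C = m%:R.
  rewrite -natr_sum exchange_big /=; congr _%:R.
  rewrite -[RHS]card_ord -sum1_card; apply: eq_bigr => i _.
  by rewrite (bigD1 (g i)) //= eqxx big1 // => C; rewrite eq_sym => /negbTE->.
have etaF C : eta C != 0 -> C \in F.
  rewrite pnatr_eq0 -lt0n => H.
  have [i /eqP <-//] : exists i, g i == C.
  apply/existsP; apply: contraT; rewrite negb_exists => /forallP no.
  by move: H; rewrite big1 // => i _; rewrite (negbTE (no i)).
have eta_le e : load eta e <= (e \in S)%:R by rewrite load_eta ler_nat.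
have eta_tight B : B \in Bs -> (forall e, e \in B -> load eta e = (e \in S)%:R) /\
    (forall C, eta C != 0 -> #|C :&: B| = 1%N).
  move=> BBs; apply: complementary_slackness => //.
  - move=> C /etaF CF; have /andP[FB _] := tBs B BBs.
    have [e eC eB] := hitsP _ _ FB C CF.
    by apply/card_gt0P; exists e; rewrite inE eC.
  - by rewrite sum_indicator BsS // sum_eta.
have load_etaS e : load eta e = (e \in S)%:R.
  have [eS|eS] := boolP (e \in S).
    have /finset.bigcupP[B BBs eB] := fintype.subsetP covBs e eS.
    by have [/(_ e eB)-> _] := eta_tight B BBs; rewrite eS.
  have := eta_le e; rewrite (negbTE eS) => le0; apply: le_anti; rewrite le0.
  by rewrite load_eta ler0n.
have etaS C : eta C != 0 -> C \subset S.
  move=> eC; apply/fintype.subsetP => e eeC.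
  have : 0 < load eta e.
    rewrite /load (bigD1 C) //= ltr_wpDr // ?lt0r ?eC /eta ?ler0n //.
    by apply: sumr_ge0 => ? _; rewrite /eta ler0n.
  by rewrite load_etaS ltr0n lt0b.
have [C1 eC1 lC1] : exists2 C, eta C != 0 & lam C = 0.
  have [//|no] := pselect (exists2 C, eta C != 0 & lam C = 0).
  have eta_lam C : lam C = 0 -> eta C = 0.
    by move=> lC; apply/eqP; apply: contraT => eC; case: no; exists C.
  have E C : eta C - nu C = 0.
    apply: (ind (fun C => eta C - nu C)) => [D lD|e].
      by rewrite eta_lam // /nu lD eqxx !subr0.
    by rewrite /load sumrB -!/(load _ e) load_etaS load_nu subrr.
  have [C lC] : exists C, lam C != 0.
    have /card_gt0P[C] : (0 < #|supp lam|)%N by rewrite card_supp // addn_gt0 k_gt0.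
    by rewrite inE; exists C.
  have := E C; rewrite /nu lC /= => /eqP; rewrite subr_eq0 => /eqP eC.
  have l0 : 0 < lam C by rewrite lt0r lC lam0.
  have l1 := optimal_lt1 opt C.
  have : 0 < eta C by rewrite eC; lra.
  have : eta C < 1 by rewrite eC; lra.
  by rewrite /eta; move: (\sum_(i < m) _)%N => q; rewrite ltrn1 ltr0n; case: q.
have C1supp : C1 \notin supp lam by rewrite inE lC1 eqxx.
have [|||mu [muT [C2 muC2] mul]] :=
    @dependent_of_large Bs (C1 |: supp lam)%SET covBs priv.
- move=> C /setU1P[->|]; first exact: etaS.
  by rewrite inE => /(optimal_sub opt).
- move=> C B /setU1P[->|CT] BBs; last exact: lamB.
  by have [_] := eta_tight B BBs; apply.
- by rewrite cardsU1 C1supp card_supp // -kmd; lia.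
have muC1 : mu C1 != 0.
  apply: contraNneq muC2 => E; apply/eqP; apply: ind => // C lC.
  have [->//|CC1] := eqVneq C C1.
  by apply: muT; rewrite !inE (negbTE CC1) lC eqxx.
(* the sign of mu that makes C1 enter the packing *)
have {C2 muC2} [mu' [mu'T mu'l mu'C1]] : exists mu' : {set T} -> rat,
    [/\ forall C, C \notin (C1 |: supp lam)%SET -> mu' C = 0,
        forall e, load mu' e = 0 & 0 < mu' C1].
  have [lt|ge] := ltP 0 (mu C1); first by exists mu.
  exists (fun C => - mu C); split.
  - by move=> C /muT->; rewrite oppr0.
  - by move=> e; rewrite /load sumrN -/(load mu e) mul oppr0.
  - by rewrite oppr_gt0 lt_neqAle muC1.
have mu'1 C : mu' C != 0 -> C = C1 \/ lam C != 0.
  move=> H; have : C \in (C1 |: supp lam)%SET by apply: contraNT H => /mu'T->.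
  by case/setU1P; [left|rewrite inE; right].
have mu'sum : \sum_C mu' C = 0.
  apply: (@sum_eq0_of_load _ B0) => // C /mu'1[->|lC].
    by have [_] := eta_tight B0 B0Bs; apply.
  by apply: lamB; rewrite ?inE.
have [||lam2 opt2 [C0 [mu'C0 lam2C0 lam2z]]] :=
    optimal_push opt _ _ mu'l mu'sum (sum0_has_neg mu'sum (lt0r_neq0 mu'C1)).
- move=> C /mu'1[->|]; first exact: etaF.
  by apply: contraNT => /lamF->.
- move=> C muC; have [E|lC] := mu'1 C (ltr0_neq0 muC).
    by have := lt_trans muC mu'C1; rewrite E ltxx.
  by rewrite lt0r lC lam0.
have [lam3 [opt3 ind3 lam3z]] := optimal_reduce opt2.
have C01 : C0 != C1 by apply: contraTneq mu'C0 => ->; rewrite -leNgt ltW.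
have lamC0 : lam C0 != 0.
  by have [E|] := mu'1 C0 (ltr0_neq0 mu'C0); first by rewrite E eqxx in C01.
have supp3 : supp lam3 = ((C1 |: supp lam) :\ C0)%SET.
  apply/eqP; rewrite eqEcard; apply/andP; split.
    apply/fintype.subsetP => C; rewrite !inE => l3.
    apply/andP; split; first by apply: contraNneq l3 => ->; apply/eqP/lam3z.
    apply: contraNT l3; rewrite negb_or negbK => /andP[CC1 /eqP lC].
    apply/eqP/lam3z/lam2z => //; apply: mu'T.
    by rewrite !inE (negbTE CC1) lC eqxx.
  rewrite (card_supp lam3) // -(card_supp lam) //.
  have := cardsD1 C0 (C1 |: supp lam)%SET.
  by rewrite cardsU1 C1supp !inE lamC0 orbT => /addnI->.
have C0S : C0 \subset S by apply: (optimal_sub opt).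
have C1S : C1 \subset S by apply: etaS.
suff E : C0 = C1 by rewrite E eqxx in C01.
apply/setP => e; have [eS|eS] := boolP (e \in S); last first.
  rewrite (contraNF (fintype.subsetP C0S e) eS).
  by rewrite (contraNF (fintype.subsetP C1S e) eS).
have load_pt (D : {set T}) : load (fun C => (C == D)%:R) e = (e \in D)%:R.
  have [eD|eD] := boolP (e \in D).
    by rewrite /load (bigD1 D) //= eqxx big1 ?addr0 // => C /andP[_ /negbTE->].
  by rewrite /load big1 // => C eC; case: eqP => // E; rewrite -E eC in eD.
have := load_supp lam3 e opt3 ind3 eS; rewrite -(load_supp lam e opt ind eS).
have -> : load (fun C => (lam3 C != 0)%:R) e =
    load (fun C => (lam C != 0)%:R) e + (e \in C1)%:R - (e \in C0)%:R.
  rewrite -!load_pt /load -big_split -sumrB; apply: eq_bigr => C _ /=.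
  have -> : (lam3 C != 0) = (C \in ((C1 |: supp lam) :\ C0)%SET) by rewrite -supp3 inE.
  rewrite !inE; have [->|_] := eqVneq C C0.
    by rewrite lamC0 (negbTE C01) /= addr0 subrr.
  have [->|_] := eqVneq C C1; first by rewrite lC1 eqxx /= add0r subr0.
  by rewrite /= addr0 subr0.
by case: (e \in C0); case: (e \in C1) => //= H; exfalso; move: H; lra.
Qed.

Lemma failure_bound : (uphalf #|T| < k)%N ->
  (k <= #|T|)%N /\ (4 * #|T| + 1 <= (#|T| + 1 - k) ^ 2)%N.
Proof.
move=> kn.
have [Bs [tBs covBs priv]] := tight_cover_family.
have [lam0 opt0] := optimal_exists.
have [lam [opt ind _]] := optimal_reduce opt0.
have dbound l : optimal l -> independent l -> (#|supp l| + #|Bs| <= #|S|.+1)%N.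
  move=> ol il; rewrite leqNgt; apply/negP.
  move=> /(dependent_of_large covBs priv)[C|C B|mu [muT [C muC] mu0]].
  - by rewrite inE => /(optimal_sub ol).
  - by rewrite inE => lC /tBs /(optimal_tight ol)[_]; apply.
  by move/eqP: muC; apply; apply: il => // D lD; apply: muT; rewrite inE lD eqxx.
have [e0 e0S] := S_nonempty.
have /finset.bigcupP[B0 B0Bs _] := fintype.subsetP covBs e0 e0S.
case: (@arg_maxnP _ B0 (mem Bs) (fun B => #|B :&: S|) B0Bs) => Bm BmBs maxm'.
have {maxm'} maxm B : B \in Bs -> (#|B :&: S| <= #|Bm :&: S|)%N by apply: maxm'.
have Sle : (#|S| <= \sum_(B in Bs) #|B :&: S|)%N.
  apply: leq_trans (_ : #|\bigcup_(B in Bs) (B :&: S)%SET| <= _)%N.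
    apply/subset_leq_card/fintype.subsetP => e eS.
    have /finset.bigcupP[B BBs eB] := fintype.subsetP covBs e eS.
    by apply/finset.bigcupP; exists B; rewrite // inE eB.
  elim/big_rec2: _ => [|B x y _ IH]; first by rewrite cards0.
  by apply: leq_trans (leq_card_setU _ _) _; rewrite leq_add2l.
have sum_le : (\sum_(B in Bs) #|B :&: S| <= #|Bs| * #|Bm :&: S|)%N.
  by rewrite -sum_nat_const; apply: leq_sum => B /maxm.
have ks := support_ge opt (tBs Bm BmBs).
have ds := dbound lam opt ind.
have ST : (#|S| <= #|T|)%N by apply: max_card.
set b := #|Bm :&: S| in maxm sum_le ks *; set d := #|Bs| in ds sum_le *.
have b1 : (0 < b)%N.
  have : (0 < #|B0 :&: S|)%N.
    have [e [eS eB _]] := priv B0 B0Bs.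
    by apply/card_gt0P; exists e; rewrite inE eB.
  by move/leq_trans; apply; apply: maxm.
have d1 : (0 < d)%N by apply/card_gt0P; exists B0.
have kbd : (k + b + d <= #|S|.+1)%N by apply: leq_trans ds; rewrite leq_add2r.
have Sdb : (#|S| <= d * b)%N by apply: leq_trans sum_le.
have [[E1 [E2 E3]]|noE] := pselect (#|S| = d * b /\ d = b /\ k + b + d = #|S|.+1)%N.
  exfalso.
  apply: (@extremal_failure_absurd Bs lam b) => //.
  - move=> B BBs.
    have : (\sum_(B in Bs) (b - #|B :&: S|) = 0)%N.
      rewrite sumnB => [|B' /maxm//].
      by apply/eqP; rewrite subn_eq0 sum_nat_const -/d -E1.
    move/eqP; rewrite sum_nat_eq0 => /forall_inP/(_ B BBs); rewrite subn_eq0 => le.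
    by apply/eqP; rewrite eqn_leq le maxm.
  - by move=> l ol il; have := dbound l ol il; rewrite -E3 leq_add2r.
  - have E4 : (b * b = #|S|)%N by rewrite E1 E2.
    by apply: (@square_side_lt _ #|T|) => //; rewrite E4 // -E3 E2.
have [q qE] : exists q, (#|S| + 1 - k = d + b + q)%N.
  by exists (#|S| + 1 - k - (d + b))%N; lia.
split; first by lia.
have -> : (#|T| + 1 - k = d + b + q + (#|T| - #|S|))%N by lia.
apply: sqrn_gap => // -[E1 [E2 E3]]; apply: noE; lia.
Qed.

End MinimalFailure.

(** Least failure in k, then least failure in w: lowering w at an element that lies
    in no cover of weight k keeps all covers at weight at least k. *)
Theorem packs_at_of_bounded (T : finType) (F : {set {set T}}) :
  (forall k, (0 < k)%N ->
     (k <= uphalf #|T|)%N \/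
     (k <= #|T|)%N /\ (4 * #|T| + 1 <= (#|T| + 1 - k) ^ 2)%N -> packs_at F k) ->
  forall k, packs_at F k.
Proof.
move=> small k; elim/ltn_ind: k => k IHk.
have [->|k0] := posnP k; first exact: packs_at0.
have [le|large] := leqP k (uphalf #|T|); first by apply: small => //; left.
have idealF : ideal_family F.
  apply: (ideal_of_packs_at (S := [set: T]%SET)) => [C _|i].
    exact: finset.subsetT.
  by rewrite cardsT => /leq_ltn_trans/(_ large)/IHk.
move=> w; have [m] := ubnP (\sum_e w e); elim: m w => // m IHm w.
rewrite ltnS => wm wF; have [//|nopack] := pselect (pack F w k).
have [wt|] := pselect (forall e, (0 < w e)%N ->
    exists2 B, hits F B && (\sum_(e in B) w e == k)%N & e \in B).
  apply: (small k k0 _ w wF); right.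
  by apply: (failure_bound idealF k0 IHk wF nopack wt).
move=> /existsNP[e /not_implyP[we noB]].
pose w' e' := (w e' - (e' == e))%N.
have ww' e' : w e' = (w' e' + (e' == e))%N.
  by rewrite /w' subnK //; case: eqP => // ->.
have [|B FB|g [gF gw]] := IHm w'; last first.
- by exists g; split=> // e'; apply: leq_trans (gw e') _; rewrite leq_subr.
- have := wF B FB; rewrite leq_eqVlt => /orP[/eqP kE|].
    have eB : e \notin B by apply/negP => ?; apply: noB;
      exists B; rewrite // FB -kE eqxx.
    rewrite kE; apply: leq_sum => e' e'B; rewrite ww'.
    case: eqP => [E|]; last by rewrite addn0.
    by rewrite -E e'B in eB.
  under eq_bigr do rewrite ww'; rewrite big_split /=.
  have : (\sum_(i in B) (i == e) <= 1)%N.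
    rewrite -big_mkcondr sum1_card -(cards1 e).
    apply/subset_leq_card/fintype.subsetP => i.
    by rewrite unfold_in inE => /andP[].
  by lia.
apply: leq_trans wm; rewrite (bigD1 e) //= [ltnRHS](bigD1 e) //=.
rewrite /w' eqxx -addSn leq_add ?subn1 ?prednK //.
by apply: leq_sum => i _; rewrite leq_subr.
Qed.

(** * Powers of square-free monomial ideals *)

Local Open Scope classical_set_scope.

(** Uniqueness of the expansion in base N. *)
Lemma digits_inj n N (f g : 'I_n -> nat) :
  (forall i, f i < N)%N -> (forall i, g i < N)%N ->
  (\sum_i f i * N ^ i = \sum_i g i * N ^ i)%N -> f =1 g.
Proof.
elim: n f g => [|n IHn] f g fN gN; first by move=> _ [].
have step (h : 'I_n.+1 -> nat) :
    (\sum_i h i * N ^ i = (\sum_(i < n) h (lift ord0 i) * N ^ i) * N + h ord0)%N.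
  rewrite big_ord_recl expn0 muln1 addnC big_distrl /=; congr addn.
  by apply: eq_bigr => i _; rewrite /bump /= add1n expnSr mulnA.
rewrite !step => E.
have N0 : (0 < N)%N by apply: leq_ltn_trans (fN ord0).
have E0 : f ord0 = g ord0.
  by have := congr1 (modn^~ N) E; rewrite !modnMDl !modn_small.
have E1 : (\sum_(i < n) f (lift ord0 i) * N ^ i =
           \sum_(i < n) g (lift ord0 i) * N ^ i)%N.
  by move/eqP: E; rewrite E0 eqn_add2r eqn_pmul2r // => /eqP.
move=> i; case: (unliftP ord0 i) => [j|] -> //.
exact: (IHn (fun j => f (lift ord0 j)) (fun j => g (lift ord0 j))).
Qed.

Lemma poly_eq0_of_roots (K : numFieldType) (p : {poly K}) :
  (forall t, p.[t] = 0) -> p = 0.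
Proof.
move=> p0; apply/eqP; apply: contraT => pn0.
have := @max_poly_roots _ p [seq i%:R | i <- iota 0 (size p)] pn0.
rewrite size_map size_iota ltnn => H; apply: H.
  by apply/allP => t _; apply/eqP/p0.
rewrite map_inj_uniq ?iota_uniq // => i j /eqP; rewrite eqr_nat.
by move/eqP.
Qed.

(** Kronecker substitution: putting the variables of B to 0 and the e-th other
    variable to the power N ^ e of one indeterminate, with N above all exponents,
    separates the monomials free of the variables of B and gives a univariate
    polynomial with infinitely many roots. *)
Lemma mcoeff_eq0_of_vanish (K : numFieldType) n (B : {set 'I_n})
    (g : {mpoly K[n]}) :
  (forall v, (forall e, e \in B -> v e = 0) -> g.@[v] = 0) ->
  forall m : 'X_{1..n}, (forall e, e \in B -> m e = 0%N) -> g@_m = 0.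
Proof.
move=> g0 m mB; pose N := (msize g + mdeg m).+1.
pose q (e : 'I_n) : {poly K} := if e \in B then 0 else 'X^(N ^ e).
pose mono (m' : 'X_{1..n}) := \prod_e q e ^+ m' e.
pose p := \sum_(m' <- msupp g) g@_m' *: mono m'.
have p0 : p = 0.
  apply: poly_eq0_of_roots => t; rewrite -[RHS](g0 (fun e => (q e).[t])).
    rewrite mevalE horner_sum; apply: eq_bigr => m' _.
    rewrite hornerZ horner_prod; congr (_ * _).
    by apply: eq_bigr => e _; rewrite horner_exp.
  by move=> e eB; rewrite /q eB horner0.
have monoE (m' : 'X_{1..n}) : (forall e, e \in B -> m' e = 0%N) ->
    mono m' = 'X^(\sum_e m' e * N ^ e).
  move=> m'B; rewrite -prodrXr; apply: eq_bigr => e _; rewrite /q.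
  by case: ifP => [/m'B->|_]; rewrite ?mul0n ?expr0 // mulnC exprM.
have mono0 (m' : 'X_{1..n}) e : e \in B -> m' e != 0%N -> mono m' = 0.
  by move=> eB m'e; rewrite /mono (bigD1 e) //= /q eB expr0n (negbTE m'e) mul0r.
have small (m' : 'X_{1..n}) e : (mdeg m' <= msize g + mdeg m)%N -> (m' e < N)%N.
  by move=> le; rewrite ltnS; apply: leq_trans le; rewrite mdegE (bigD1 e) //= leq_addr.
have [mg|/memN_msupp_eq0//] := boolP (m \in msupp g).
have := congr1 (fun r : {poly K} => r`_(\sum_e m e * N ^ e)%N) p0.
rewrite coef0 /p coef_sum (bigD1_seq m) ?msupp_uniq //= coefZ monoE //.
rewrite coefXn eqxx mulr1.
rewrite big_seq_cond big1 ?addr0 // => m' /andP[m'g m'm]; rewrite coefZ.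
have [[e eB m'e]|no] := pselect (exists2 e, e \in B & m' e != 0%N).
  by rewrite (mono0 _ e) // coef0 mulr0.
have m'B e : e \in B -> m' e = 0%N.
  by move=> eB; apply/eqP; apply: contraT => m'e; case: no; exists e.
rewrite monoE // coefXn; case: eqP => [E|]; last by rewrite mulr0.
case/eqP: m'm; apply/mnmP => e; apply/esym.
apply: (@digits_inj n N m m' _ _ E) => e'; apply: small.
  by rewrite leq_addl.
by apply: leq_trans (leq_addr _ _); apply/ltnW/msize_mdeg_lt.
Qed.

Section MonomialIdeals.

Variables (K : numFieldType) (n : nat) (F : {set {set 'I_n}}).

Local Notation G := (@sqfree_gens K n F).
Local Notation I := (ideal_gen G).

Lemma ideal_gen_ideal (A : comNzRingType) (X : set A) : is_ideal (ideal_gen X).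
Proof.
split=> [J [[]]//|x y Jx Jy J JX|a x Jx J JX].
  by have [[_ JD _] _] := JX; apply: JD; [exact: Jx|exact: Jy].
by have [[_ _ JM] _] := JX; apply: JM; exact: Jx.
Qed.

Lemma ideal_sum (A : comNzRingType) (J : set A) (T : eqType) (r : seq T) (f : T -> A) :
  is_ideal J -> (forall i, i \in r -> J (f i)) -> J (\sum_(i <- r) f i).
Proof.
move=> [J0 JD _] Jf; rewrite big_seq; elim/big_rec: _ => // i x ir Jx.
by apply: JD => //; apply: Jf.
Qed.

Lemma sqfree_monomialE (C : {set 'I_n}) : sqfree_monomial K C = 'X_[mesym1 C].
Proof.
rewrite /sqfree_monomial mprodXE; congr 'X_[_]; apply/mnmP => e.
rewrite mnm_sumE mnmE big_mkcond (bigD1 e) //= mnm1E eqxx big1 => [|e' e'e].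
  by rewrite addn0; case: (e \in C).
by rewrite mnm1E (negbTE e'e) if_same.
Qed.

Lemma ordinary_powerP k (f : {mpoly K[n]}) :
  ordinary_power G k f <-> forall m, m \in msupp f -> pack F m k.
Proof.
split=> [|fk].
  move: f; apply: (@smallest_sub _ (@is_ideal _) _
    [set f | forall m, m \in msupp f -> pack F m k]).
    split=> [m|f g fk gk m|a f fk m]; first by rewrite msupp0.
      by move=> /msuppD_le; rewrite mem_cat => /orP[/fk|/gk].
    move=> /msuppM_le /allpairsP[[m1 m2] /= [_ /fk[g [gF gm]] ->]].
    exists g; split=> // e; rewrite mnmDE; apply: leq_trans (gm e) _.
    exact: leq_addl.
  move=> _ [g [gG ->]] m.
  have /choice[C gC] : forall i, exists C, C \in F /\ g i = 'X_[mesym1 C].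
    by move=> i; have [C CF <-] := gG i; exists C; rewrite sqfree_monomialE.
  rewrite (eq_bigr (fun i => 'X_[mesym1 (C i)])) => [|i _]; last by case: (gC i).
  rewrite mprodXE msuppX inE => /eqP->; exists C; split=> [i|e]; first by case: (gC i).
  by rewrite mnm_sumE; apply: leq_sum => i _; rewrite mnmE.
have Iid := ideal_gen_ideal (kfold_products G k).
rewrite [f]mpolyE; apply: ideal_sum => // m /fk[g [gF gm]].
have [_ _ JM] := Iid.
pose mg := (\sum_(i < k) mesym1 (g i))%MM.
have le : (mg <= m)%MM.
  apply/mnm_lepP => e; rewrite mnm_sumE; apply: leq_trans (gm e).
  by apply: leq_sum => i _; rewrite mnmE.
rewrite -(submK le) mpolyXD scalerAl; apply: JM; apply: sub_gen_smallest.
exists (fun i => 'X_[mesym1 (g i)]); split; last by rewrite mprodXE.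
by move=> i; exists (g i); rewrite /= ?gF // sqfree_monomialE.
Qed.

Lemma zero_locusP (v : 'I_n -> K) :
  zero_locus I v <-> hits F [set e | v e == 0]%SET.
Proof.
have evalE C : (sqfree_monomial K C).@[v] = \prod_(e in C) v e.
  by rewrite /sqfree_monomial rmorph_prod; apply: eq_bigr => e _; apply: mevalXU.
split=> [Iv|/hitsP vF].
  apply/hitsP => C CF.
  have /eqP : (sqfree_monomial K C).@[v] = 0.
    by apply: Iv; apply: sub_gen_smallest; exists C.
  by rewrite evalE => /prodf_eq0[e eC ve]; exists e; rewrite ?inE.
apply: (@smallest_sub _ (@is_ideal _) _ [set f | f.@[v] = 0]).
  split=> [|f g /= f0 g0|a f /= f0]; first exact: meval0.
    by rewrite /= mevalD f0 g0 addr0.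
  by rewrite /= mevalM f0 mulr0.
move=> _ [C CF <-] /=; rewrite evalE; have [e eC] := vF C CF.
by rewrite inE => /eqP ve; rewrite (bigD1 e) //= ve mul0r.
Qed.

(** If m has weight below k on a cover B, the derivative by the B-part of m has
    order below k and turns the coefficient of m into that of a monomial free of the
    variables of B, which must vanish. Conversely, a derivative of order below k
    leaves a positive exponent on some variable of each cover. *)
Lemma symbolic_powerP k (f : {mpoly K[n]}) : (0 < k)%N ->
  symbolic_power I k f <->
  forall m, m \in msupp f -> forall B, hits F B -> (k <= \sum_(e in B) m e)%N.
Proof.
move=> k0; split=> [fk m mf B FB|fk m mk v /zero_locusP vF].
  rewrite leqNgt; apply/negP => mB.
  (* the parts of m on B, by which to differentiate, and off B, which survives *)
  pose mb : 'X_{1..n} := [multinom (if e \in B then m e else 0%N) | e < n].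
  pose mr : 'X_{1..n} := [multinom (if e \in B then 0%N else m e) | e < n].
  have mE : (mb + mr)%MM = m.
    by apply/mnmP => e; rewrite mnmDE !mnmE; case: ifP; rewrite ?addn0.
  have mbk : (mdeg mb <= k - 1)%N.
    rewrite mdegE -ltnS subn1 prednK //; move: mB; rewrite big_mkcond.
    by apply: leq_ltn_trans; apply: leq_sum => e _; rewrite mnmE.
  have /eqP : (f^`M[mb])@_mr = 0.
    apply: (@mcoeff_eq0_of_vanish _ _ B) => [v vB|e eB]; last by rewrite mnmE eB.
    apply: (fk mb mbk); apply/zero_locusP/hitsP => C CF.
    have [e eC eB] := hitsP _ _ FB C CF; exists e => //.
    by rewrite inE vB.
  rewrite mcoeff_mderivm mE -mulr_natr mulf_eq0 pnatr_eq0 mcoeff_eq0 mf /=.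
  rewrite -leqn0 leqNgt prodn_gt0 // => e; rewrite ffact_gt0 mnmE.
  by case: ifP.
rewrite mderivmE raddf_sum big_seq big1 // => m' m'f /=.
rewrite mevalZ mevalX.
have := fk m' m'f _ vF; set B := [set e | v e == 0]%SET => m'B.
have [e eB em] : exists2 e, e \in B & (m e < m' e)%N.
  have [//|no] := pselect (exists2 e, e \in B & (m e < m' e)%N).
  move: m'B; rewrite leqNgt => /negP[].
  apply: leq_ltn_trans (_ : \sum_(e in B) m e < k)%N.
    by apply: leq_sum => e eB; rewrite leqNgt; apply/negP => em; apply: no; exists e.
  apply: leq_ltn_trans (_ : mdeg m < k)%N; last by lia.
  by rewrite mdegE [leqRHS](bigID (mem B)) /= leq_addr.
move: eB; rewrite inE => /eqP ve.
by rewrite [X in _ * X](bigD1 e) //= ve mnmBE expr0n subn_eq0 leqNgt em mul0r mulr0.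
Qed.

Lemma pack_hits (w : 'I_n -> nat) k B : pack F w k -> hits F B ->
  (k <= \sum_(e in B) w e)%N.
Proof.
move=> wk FB; rewrite -(ler_nat rat) natr_sum.
have := @pack_weight _ _ _ _ (fun e => (e \in B)%:R) 1 wk.
rewrite mul1r big_mkcond => H; apply: le_trans (H _ _) _ => [e|C CF|].
- exact: ler0n.
- rewrite sum_indicator ler1n; have [e eC eB] := hitsP _ _ FB C CF.
  by apply/card_gt0P; exists e; rewrite inE eC.
rewrite big_mkcond [leRHS]big_mkcond; apply: ler_sum => e _.
by case: (e \in B); rewrite ?mul1r ?mul0r.
Qed.

Lemma power_eqP k : (0 < k)%N ->
  ordinary_power G k = symbolic_power I k <-> packs_at F k.
Proof.
move=> k0; split=> [E w wF|Fk].
  pose m : 'X_{1..n} := [multinom w e | e < n].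
  have : symbolic_power I k 'X_[m].
    apply/symbolic_powerP => // m'; rewrite msuppX inE => /eqP-> B FB.
    by rewrite (eq_bigr w) ?wF // => e _; rewrite mnmE.
  rewrite -E => /ordinary_powerP/(_ m); rewrite msuppX inE eqxx => /(_ isT).
  by case=> g [gF gm]; exists g; split=> // e; have := gm e; rewrite mnmE.
apply/seteqP; split=> f.
  move/ordinary_powerP => fk; apply/symbolic_powerP => // m /fk mk B.
  exact: pack_hits.
by move/symbolic_powerP => /(_ k0) fk; apply/ordinary_powerP => m /fk /Fk.
Qed.

End MonomialIdeals.

Lemma bound_of_sqr (R : realType) (n k : nat) :
  (k <= n)%N -> (4 * n + 1 <= (n + 1 - k) ^ 2)%N ->
  k%:Z <= Num.floor (n%:R - Num.sqrt (4 * n%:R + 1) + 1 : R).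
Proof.
move=> kn sq; rewrite floor_ge_int -pmulrn.
have : Num.sqrt (4 * n%:R + 1) <= (n + 1 - k)%N%:R :> R.
  rewrite -[leRHS]ger0_norm // -sqrtr_sqr; apply: ler_wsqrtr.
  by rewrite -natrX -natrM natr1 ler_nat -addn1.
rewrite natrB; last by lia.
by rewrite natrD; lra.
Qed.

Lemma bound_of_uphalf (R : realType) (n k : nat) :
  (k <= uphalf n)%N -> k%:Z <= Num.ceil (n%:R / 2 : R).
Proof.
move=> kn; rewrite -(subrK 1 k%:Z) lezD1 ceil_gt_int.
have : (k.*2 <= n.+1)%N by lia.
rewrite -(ler_nat R) -muln2 natrM -[n.+1%:R]natr1.
rewrite intrB -pmulrn; lra.
Qed.

Theorem corollary6 (R : realType) (n : nat) (F : {set {set 'I_n}})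
    (G : set {mpoly R[i][n]}) (I : set {mpoly R[i][n]})
    (hG : G = sqfree_gens F) (hI : I = ideal_gen G) :
  (forall k : nat, (1 <= k)%N -> ordinary_power G k = symbolic_power I k)
  <->
  (forall k : nat, (1 <= k)%N ->
     k%:Z <= Num.max (Num.ceil (n%:R / 2 : R))
                      (Num.floor (n%:R - Num.sqrt (4 * n%:R + 1) + 1 : R)) ->
     ordinary_power G k = symbolic_power I k).
Proof.
split=> [H k k0 _|H k k0]; first exact: H.
subst I G; apply/power_eqP => //; apply: packs_at_of_bounded => {k0}k k0 bound.
apply/(power_eqP R[i] F k0)/H => //; rewrite le_max.
rewrite card_ord in bound.
case: bound => [le|[kn sq]].
  by rewrite (bound_of_uphalf R le).
by rewrite (bound_of_sqr R kn sq) orbT.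
Qed.
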